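(* Let $\mathbb{A}=\langle A;L(\mathbb{A})\rangle$ and $\mathbb{B}=\langle B;L(\mathbb{B})\rangle$ be algebraic structures. Then the following hold. (1) For any interpretation $(\Gamma,\bar p,\mu_\Gamma)\colon\mathbb{A}\rightsquigarrow\mathbb{B}$ there exist an extended code $(\Gamma,\bar p,\gamma)\colon L(\mathbb{A})\cup A\to L(\mathbb{B})\cup B$ with $\mu_\Gamma\circ\gamma=\mathrm{id}_A$, and the interpretation $(\Gamma,\bar p,\gamma)$-functor $\mathcal{F}\colon\mathcal{PLS}(\mathbb{A})\to\mathcal{PLS}(\mathbb{B})$. (2) For any extended code $(\Gamma,\bar p,\gamma)\colon L(\mathbb{A})\cup A\to L(\mathbb{B})\cup B$, if the interpretation $(\Gamma,\bar p,\gamma)$-functor $\mathcal{F}\colon\mathcal{PLS}(\mathbb{A})\to\mathcal{PLS}(\mathbb{B})$ exists, then there exists an interpretation $(\Gamma,\bar p,\mu_\Gamma)\colon\mathbb{A}\rightsquigarrow\mathbb{B}$ such that $\mu_\Gamma\circ\gamma=\mathrm{id}_A$. In both cases $\gamma(A)\subseteq U_\Gamma(\mathbb{B},\bar p)$ and $\mathcal{F}$ is an embedding (a faithful functor that is injective on objects), which is also a functor $\mathcal{F}\colon\mathcal{PLS}_{\alpha,\beta}(\mathbb{A})\to\mathcal{PLS}_{\alpha,\beta}(\mathbb{B})$ for any infinite cardinals $\alpha\leqslant\beta$.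
   Context: **Structures and codes.** $\mathbb{A}=\langle A;L(\mathbb{A})\rangle$ denotes a first-order structure with non-empty underlying set $A$ in the language $L(\mathbb{A})$ (logic with equality; constant, function and predicate symbols); similarly for other letters. For $P\subseteq A$, $\mathbb{A}_P$ is the expansion of $\mathbb{A}$ by constants naming the elements of $P$. Maps are applied to tuples coordinatewise. An interpretation code $\Gamma\colon L(\mathbb{A})\to L(\mathbb{B})$ is a family of $L(\mathbb{B})$-formulas $U_\Gamma(\bar x,\bar y)$, $E_\Gamma(\bar x,\bar x',\bar y)$, $c_\Gamma(\bar x,\bar y)$, $f_\Gamma(\bar x_0,\bar x_1,\ldots,\bar x_{n_f},\bar y)$, $R_\Gamma(\bar x_1,\ldots,\bar x_{n_R},\bar y)$, one for each constant symbol $c$, function symbol $f$, predicate symbol $R$ of $L(\mathbb{A})$, where all tuples $\bar x,\bar x',\bar x_i$ have the same length $\dim\Gamma$ and $|\bar y|=\dim_{\mathrm{par}}\Gamma$. For a tuple $\bar p$ from $B$ with $|\bar p|=\dim_{\mathrm{par}}\Gamma$ put $U_\Gamma(\mathbb{B},\bar p)=\{\bar b\mid\mathbb{B}\models U_\Gamma(\bar b,\bar p)\}$. The $L(\mathbb{A})$-structure $\Gamma(\mathbb{B},\bar p)$ is well-defined if $U_\Gamma(\mathbb{B},\bar p)\neq\emptyset$ and, on $U_\Gamma(\mathbb{B},\bar p)$, $E_\Gamma(\cdot,\cdot,\bar p)$ defines an equivalence relation $\sim_\Gamma$, each $c_\Gamma$ defines exactly one $\sim_\Gamma$-class, each $f_\Gamma$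 defines (the preimage of) the graph $x_0=f(x_1,\ldots,x_{n_f})$ of an operation on $U_\Gamma(\mathbb{B},\bar p)/{\sim_\Gamma}$, and each $R_\Gamma$ defines (the preimage of) a relation on $U_\Gamma(\mathbb{B},\bar p)/{\sim_\Gamma}$; then $\Gamma(\mathbb{B},\bar p)$ is the resulting structure on $U_\Gamma(\mathbb{B},\bar p)/{\sim_\Gamma}$. An interpretation $(\Gamma,\bar p,\mu_\Gamma)\colon\mathbb{A}\rightsquigarrow\mathbb{B}$ consists of a code $\Gamma$, a tuple $\bar p$ such that $\Gamma(\mathbb{B},\bar p)$ is well-defined, and a surjection (coordinate map) $\mu_\Gamma\colon U_\Gamma(\mathbb{B},\bar p)\to A$ that induces an $L(\mathbb{A})$-isomorphism $\bar\mu_\Gamma\colon\Gamma(\mathbb{B},\bar p)\to\mathbb{A}$, $\bar\mu_\Gamma(\bar b/{\sim_\Gamma})=\mu_\Gamma(\bar b)$. **Translations.** A formula is in normal form if it is prenex and its matrix is a disjunction of conjunctions of unnested atomic formulas ($x=x'$, $x=c$, $f(x_1,\ldots,x_{n_f})=x_0$, $R(x_1,\ldots,x_{n_R})$) and their negations. For an $L(\mathbb{A})$-formula $\psi(x_1,\ldots,x_s)$ in normal form, $\psi_\Gamma(\bar x_1,\ldots,\bar x_s,\bar y)$ is the $L(\mathbb{B})$-formula obtained by replacing each variable by a tuple of $\dim\Gamma$ variables, replacing the unnested atomic formulas by $E_\Gamma,c_\Gamma,f_\Gamma,R_\Gamma$ respectively, relativizing all quantifiers to $U_\Gamma(\cdot,\bar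 y)$, and adding the conjuncts $U_\Gamma(\bar x_i,\bar y)$ for all listed free variables. A formula not in normal form is translated via a logically equivalent normal form. An extended code $(\Gamma,\bar p,\gamma)\colon L(\mathbb{A})\cup A\to L(\mathbb{B})\cup B$ consists of a code $\Gamma\colon L(\mathbb{A})\to L(\mathbb{B})$, a tuple $\bar p$ from $B$ with $|\bar p|=\dim_{\mathrm{par}}\Gamma$, and a map $\gamma\colon A\to B^{\dim\Gamma}$. For a formula $\psi(x_1,\ldots,x_m,a_1,\ldots,a_s)$ of $L(\mathbb{A})\cup A$ (with constants $a_i\in A$) put $\psi_{\Gamma,\bar p,\gamma}(\bar x_1,\ldots,\bar x_m)=\psi_\Gamma(\bar x_1,\ldots,\bar x_m,\gamma(a_1),\ldots,\gamma(a_s),\bar p)$, where $\psi_\Gamma$ is the translation of $\psi(x_1,\ldots,x_m,z_1,\ldots,z_s)$. **Projective logical geometry.** For a set $S$ of $L(\mathbb{A})\cup A$-formulas in free variables $x_1,\ldots,x_m$ put $\mathrm{V}_{\mathbb{A}}(S)=\{\bar a\in A^m\mid\mathbb{A}_A\models\psi(\bar a)\ \forall\psi\in S\}$. Sets $X=\mathrm{V}_{\mathbb{A}}(S)$ are the logical sets over $\mathbb{A}$; $X$ is an $(\alpha,\beta)$-logical set ($\alpha\leqslant\beta$ infinite cardinals; the symbol $\infty$ means no restriction) if $S$ can be chosen with $|S|<\beta$ and fewer than $\alpha$ parameters from $A$. The $(\omega,\omega)$-logical sets are the definable sets. An equivalence relation $\sim_X$ on a non-empty logical set $X\subseteq A^m$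 is a formula equivalence, induced by an $L(\mathbb{A})\cup A$-formula $E(\bar x,\bar x')$, if for all $\bar a,\bar a'\in X$: $\bar a\sim_X\bar a'$ iff $\mathbb{A}_A\models E(\bar a,\bar a')$; and for all $\bar a\in X$, $\bar a'\in A^m$, $\mathbb{A}_A\models E(\bar a,\bar a')\vee E(\bar a',\bar a)$ implies $\bar a'\in X$. A projective logical set over $\mathbb{A}$ is a quotient $X/{\sim_X}$ of a non-empty logical set by a formula equivalence ($X$ is identified with $X/{=}$); it is an $(\alpha,\beta)$-projective logical set if $X$ is $(\alpha,\beta)$-logical, and a projective definable set if $X$ is definable. A map $F\colon X/{\sim_X}\to Y/{\sim_Y}$ ($X\subseteq A^m$, $Y\subseteq A^s$) is a formula map, induced by an $L(\mathbb{A})\cup A$-formula $\varphi(\bar x,\bar y)$, if (I) for all $\bar a\in X,\bar b\in Y$: $F(\bar a/{\sim_X})=\bar b/{\sim_Y}$ iff $\mathbb{A}_A\models\varphi(\bar a,\bar b)$; (II) $\bar a\in X,\bar b\in A^s\setminus Y$ implies $\mathbb{A}_A\not\models\varphi(\bar a,\bar b)$. The category $\mathcal{PLS}(\mathbb{A})$ has as objects all projective logical sets over $\mathbb{A}$ and $\emptyset$; morphisms between non-empty objects are the formula maps; $\emptyset$ is an initial object and there are no morphisms from non-empty objects to $\emptyset$. $\mathcal{PLS}_{\alpha,\beta}(\mathbb{A})$ is the full subcategory of $(\alpha,\beta)$-projective logical sets (and $\emptyset$). **Translation and interpretation functors.** Let $(\Gamma,\bar p,\gamma)\colon L(\mathbb{A})\cup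 A\to L(\mathbb{B})\cup B$ be an extended code; for a set $S$ of formulas put $S_{\Gamma,\bar p,\gamma}=\{\psi_{\Gamma,\bar p,\gamma}\mid\psi\in S\}$. Consider the following conditions, where all systems $S,S',S_X,\ldots$ are non-empty sets of formulas in finitely many free variables, with fewer than $\beta$ formulas and fewer than $\alpha$ parameters from $A$, and for $X=\mathrm{V}_{\mathbb{A}}(S_X)$ we write $\bar X=\mathrm{V}_{\mathbb{B}}((S_X)_{\Gamma,\bar p,\gamma})$ (conditions required for all choices of normal forms): (F1) $\mathrm{V}_{\mathbb{A}}(S)=\emptyset$ iff $\mathrm{V}_{\mathbb{B}}(S_{\Gamma,\bar p,\gamma})=\emptyset$; (F2) $\mathrm{V}_{\mathbb{A}}(S)=\mathrm{V}_{\mathbb{A}}(S')$ implies $\mathrm{V}_{\mathbb{B}}(S_{\Gamma,\bar p,\gamma})=\mathrm{V}_{\mathbb{B}}(S'_{\Gamma,\bar p,\gamma})$; (F3) if $E$ induces a formula equivalence on $X\ne\emptyset$, then $E_{\Gamma,\bar p,\gamma}$ induces a formula equivalence on $\bar X$; (F4) if $E,E'$ induce the same formula equivalence on $X$, then so do $E_{\Gamma,\bar p,\gamma},E'_{\Gamma,\bar p,\gamma}$ on $\bar X$; (F5) if $\varphi$ induces a formula map $X/{\sim_X}\to Y/{\sim_Y}$, then $\varphi_{\Gamma,\bar p,\gamma}$ induces a formula map $\bar X/{\sim_{\bar X}}\to\bar Y/{\sim_{\bar Y}}$, where $\sim_{\bar X},\sim_{\bar Y}$ are induced by the translations of formulas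 inducing $\sim_X,\sim_Y$; (F6) if $\varphi,\varphi'$ induce the same formula map, then so do $\varphi_{\Gamma,\bar p,\gamma},\varphi'_{\Gamma,\bar p,\gamma}$; (F7) if $\varphi_{XY},\varphi_{YZ}$ induce formula maps $X/{\sim_X}\to Y/{\sim_Y}$, $Y/{\sim_Y}\to Z/{\sim_Z}$, then the composition of the formula maps induced by their translations is induced by the translation of $\exists\bar y(\varphi_{XY}(\bar x,\bar y)\wedge\varphi_{YZ}(\bar y,\bar z))$. If (F1)–(F7) hold for $(\alpha,\beta)$, one says that the (translation) $(\Gamma,\bar p,\gamma)$-functor $\mathcal{F}=\mathcal{F}_{\Gamma,\bar p,\gamma}\colon\mathcal{PLS}_{\alpha,\beta}(\mathbb{A})\to\mathcal{PLS}_{\alpha,\beta}(\mathbb{B})$ exists (is well-defined): $\mathcal{F}(\emptyset)=\emptyset$, $\mathcal{F}(X/{\sim_X})=\bar X/{\sim_{\bar X}}$, $\mathcal{F}(\emptyset\to O)=(\emptyset\to\mathcal{F}(O))$, and $\mathcal{F}$ sends the formula map induced by $\varphi$ to the one induced by $\varphi_{\Gamma,\bar p,\gamma}$. For $(\alpha,\beta)=(\infty,\infty)$ it is called the interpretation $(\Gamma,\bar p,\gamma)$-functor. *)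

(* Defs.v *)
From mathcomp Require Import all_boot all_algebra.
From mathcomp Require Import all_classical.

Set Implicit Arguments.
Unset Strict Implicit.
Unset Printing Implicit Defensive.

Local Open Scope classical_set_scope.
Local Open Scope card_scope.

(* An n-tuple of elements of T is a function 'I_n -> T; [vcat] concatenates
   tuples, or more generally families, into a function on the sum of the index
   types. *)
Definition vcat (V W T : Type) (v : V -> T) (w : W -> T) (x : V + W) : T :=
  match x with inl i => v i | inr j => w j end.

Definition no_ord (T : Type) (i : 'I_0) : T.
Proof. by case: i. Defined.

(* Arities may be 0. *)
Record language := Language {
  cst : Type;
  fct : Type;
  fct_ar : fct -> nat;
  prd : Type;
  prd_ar : prd -> nat }.

Record structure (L : language) := Structure {
  carrier :> Type;
  carrier_inh : inhabited carrier;
  icst : cst L -> carrier;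
  ifct : forall f : fct L, ('I_(fct_ar f) -> carrier) -> carrier;
  iprd : forall R : prd L, ('I_(prd_ar R) -> carrier) -> Prop }.

Inductive term (L : language) (V : Type) : Type :=
| Var (x : V)
| Cst (c : cst L)
| App (f : fct L) (ts : 'I_(fct_ar f) -> term L V).

(* [formula L V]: formulas whose free variables are taken from the type V; a
   quantifier binds the variable [None] of [option V]. *)
Inductive formula (L : language) (V : Type) : Type :=
| Eq (t u : term L V)
| Rel (R : prd L) (ts : 'I_(prd_ar R) -> term L V)
| Neg (phi : formula L V)
| And (phi psi : formula L V)
| Or (phi psi : formula L V)
| Imp (phi psi : formula L V)
| Ex (phi : formula L (option V))
| All (phi : formula L (option V)).

Arguments Var {L V} x.
Arguments Cst {L V} c.
Arguments App {L V} f ts.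
Arguments Eq {L V} t u.
Arguments Rel {L V} R ts.
Arguments Neg {L V} phi.
Arguments And {L V} phi psi.
Arguments Or {L V} phi psi.
Arguments Imp {L V} phi psi.
Arguments Ex {L V} phi.
Arguments All {L V} phi.

Fixpoint eval (L : language) (M : structure L) (V : Type) (v : V -> M)
    (t : term L V) : M :=
  match t with
  | Var x => v x
  | Cst c => icst M c
  | App f ts => ifct (fun i => eval v (ts i))
  end.

Fixpoint sat (L : language) (M : structure L) (V : Type) (phi : formula L V) :
    (V -> M) -> Prop :=
  match phi with
  | Eq t u => fun v => eval v t = eval v u
  | Rel R ts => fun v => iprd (fun i => eval v (ts i))
  | Neg phi => fun v => ~ sat phi v
  | And phi psi => fun v => sat phi v /\ sat psi v
  | Or phi psi => fun v => sat phi v \/ sat psi v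
  | Imp phi psi => fun v => sat phi v -> sat psi v
  | Ex phi => fun v => exists a : M, sat phi (oapp v a)
  | All phi => fun v => forall a : M, sat phi (oapp v a)
  end.

Definition logically_equivalent (L : language) (V : Type)
    (phi psi : formula L V) : Prop :=
  forall (M : structure L) (v : V -> M), sat phi v <-> sat psi v.

Fixpoint tren (L : language) (V W : Type) (r : V -> W) (t : term L V) :
    term L W :=
  match t with
  | Var x => Var (r x)
  | Cst c => Cst c
  | App f ts => App f (fun i => tren r (ts i))
  end.

Fixpoint fren (L : language) (V W : Type) (r : V -> W) (phi : formula L V) :
    formula L W :=
  match phi with
  | Eq t u => Eq (tren r t) (tren r u)
  | Rel R ts => Rel R (fun i => tren r (ts i))
  | Neg phi => Neg (fren r phi)
  | And phi psi => And (fren r phi) (fren r psi)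
  | Or phi psi => Or (fren r phi) (fren r psi)
  | Imp phi psi => Imp (fren r phi) (fren r psi)
  | Ex phi => Ex (fren (omap r) phi)
  | All phi => All (fren (omap r) phi)
  end.

(* Quantification over a whole tuple of variables: [exs n phi] and
   [alls n phi] bind the n variables [inr i] of phi. *)
Definition push (n : nat) (V : Type) (x : V + 'I_n.+1) : option (V + 'I_n) :=
  match x with
  | inl v => Some (inl v)
  | inr i => omap inr (unlift ord0 i)
  end.

Fixpoint exs (L : language) (V : Type) (n : nat) :
    formula L (V + 'I_n) -> formula L V :=
  match n with
  | 0 => fren (vcat id (no_ord V))
  | n'.+1 => fun phi => exs (Ex (fren (@push n' V) phi))
  end.

Fixpoint alls (L : language) (V : Type) (n : nat) :
    formula L (V + 'I_n) -> formula L V :=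
  match n with
  | 0 => fren (vcat id (no_ord V))
  | n'.+1 => fun phi => alls (All (fren (@push n' V) phi))
  end.

Definition lang_with (L : language) (P : Type) : language :=
  {| cst := (cst L + P)%type;
     fct := fct L; fct_ar := @fct_ar L;
     prd := prd L; prd_ar := @prd_ar L |}.

Definition expansion (L : language) (A : structure L) :
    structure (lang_with L A) :=
  @Structure (lang_with L A) A (carrier_inh A)
    (fun c => match c with inl c0 => icst A c0 | inr a => a end)
    (fun f => @ifct L A f) (fun R => @iprd L A R).

Definition pform (L : language) (A : structure L) (V : Type) : Type :=
  formula (lang_with L A) V.

Definition psat (L : language) (A : structure L) (V : Type)
    (phi : pform A V) (v : V -> A) : Prop :=
  sat (M := expansion A) phi v.

(* [fname r phi] replaces every variable x of phi by the variable or by the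
   new constant [r x]. *)
Fixpoint tname (L : language) (P V W : Type) (r : W -> V + P)
    (t : term L W) : term (lang_with L P) V :=
  match t with
  | Var x => match r x with
             | inl y => Var y
             | inr a => @Cst (lang_with L P) V (inr a)
             end
  | Cst c => @Cst (lang_with L P) V (inl c)
  | App f ts => @App (lang_with L P) V f (fun i => tname r (ts i))
  end.

Definition lift_name (P V W : Type) (r : W -> V + P) (x : option W) :
    option V + P :=
  match x with
  | None => inl None
  | Some w => match r w with inl y => inl (Some y) | inr a => inr a end
  end.

Fixpoint fname (L : language) (P V W : Type) (r : W -> V + P)
    (phi : formula L W) : formula (lang_with L P) V :=
  match phi with
  | Eq t u => Eq (tname r t) (tname r u)
  | Rel R ts => @Rel (lang_with L P) V R (fun i => tname r (ts i))
  | Neg phi => Neg (fname r phi)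
  | And phi psi => And (fname r phi) (fname r psi)
  | Or phi psi => Or (fname r phi) (fname r psi)
  | Imp phi psi => Imp (fname r phi) (fname r psi)
  | Ex phi => Ex (fname (lift_name r) phi)
  | All phi => All (fname (lift_name r) phi)
  end.

Fixpoint toccurs (L : language) (P V : Type) (a : P)
    (t : term (lang_with L P) V) : Prop :=
  match t with
  | Var _ => False
  | Cst c => match c with inl _ => False | inr b => a = b end
  | App f ts => exists i, toccurs a (ts i)
  end.

Fixpoint foccurs (L : language) (P V : Type) (a : P)
    (phi : formula (lang_with L P) V) : Prop :=
  match phi with
  | Eq t u => toccurs a t \/ toccurs a u
  | Rel R ts => exists i, toccurs a (ts i)
  | Neg phi => foccurs a phi
  | And phi psi | Or phi psi | Imp phi psi => foccurs a phi \/ foccurs a psi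
  | Ex phi | All phi => foccurs a phi
  end.

Inductive atom (L : language) (V : Type) : Type :=
| AEq (x x' : V)
| ACst (x : V) (c : cst L)
| AFun (f : fct L) (xs : 'I_(fct_ar f) -> V) (x0 : V)
| ARel (R : prd L) (xs : 'I_(prd_ar R) -> V).

Inductive literal (L : language) (V : Type) : Type :=
| Pos (a : atom L V)
| Opp (a : atom L V).

Inductive conjunction (L : language) (V : Type) : Type :=
| ConjOne (l : literal L V)
| ConjCons (l : literal L V) (c : conjunction L V).

Inductive dnf (L : language) (V : Type) : Type :=
| DnfOne (c : conjunction L V)
| DnfCons (c : conjunction L V) (d : dnf L V).

Inductive nform (L : language) (V : Type) : Type :=
| NMat (d : dnf L V)
| NEx (phi : nform L (option V))
| NAll (phi : nform L (option V)).

Definition atom_form (L : language) (V : Type) (a : atom L V) : formula L V :=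
  match a with
  | AEq x x' => Eq (Var x) (Var x')
  | ACst x c => Eq (Var x) (Cst c)
  | AFun f xs x0 => Eq (App f (fun i => Var (xs i))) (Var x0)
  | ARel R xs => Rel R (fun i => Var (xs i))
  end.

(* The three maps below turn literals, conjunctions and disjunctions into
   formulas, given the formulas that stand for the atoms; they serve both for
   reading a normal form as a formula and for translating it. *)
Definition literal_form (L L' : language) (V W : Type)
    (h : atom L V -> formula L' W) (l : literal L V) : formula L' W :=
  match l with Pos a => h a | Opp a => Neg (h a) end.

Fixpoint conj_form (L L' : language) (V W : Type)
    (h : atom L V -> formula L' W) (c : conjunction L V) : formula L' W :=
  match c with
  | ConjOne l => literal_form h l
  | ConjCons l c => And (literal_form h l) (conj_form h c)
  end.

Fixpoint dnf_form (L L' : language) (V W : Type)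
    (h : atom L V -> formula L' W) (d : dnf L V) : formula L' W :=
  match d with
  | DnfOne c => conj_form h c
  | DnfCons c d => Or (conj_form h c) (dnf_form h d)
  end.

Fixpoint nform_form (L : language) (V : Type) (phi : nform L V) : formula L V :=
  match phi with
  | NMat d => dnf_form (@atom_form L V) d
  | NEx phi => Ex (nform_form phi)
  | NAll phi => All (nform_form phi)
  end.

(* A tuple of n tuples of length d is indexed by 'I_n * 'I_d. In [cF] the first
   tuple is the one for the value of the function. The dimension has to be
   positive: in dimension 0 all the powers of A would be sent to the same B^0. *)
Record code (LA LB : language) := Code {
  cdim : nat;
  cdim_gt0 : (0 < cdim)%N;
  cpar : nat;
  cU : formula LB ('I_cdim + 'I_cpar);
  cE : formula LB ('I_cdim + 'I_cdim + 'I_cpar);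
  cC : cst LA -> formula LB ('I_cdim + 'I_cpar);
  cF : forall f : fct LA,
         formula LB ('I_cdim + 'I_(fct_ar f) * 'I_cdim + 'I_cpar);
  cR : forall R : prd LA, formula LB ('I_(prd_ar R) * 'I_cdim + 'I_cpar) }.

(* The set of classes X/R; the class of a consists of the b in X with R a b. *)
Definition quot (T : Type) (X : set T) (R : T -> T -> Prop) : Type :=
  {C : set T | exists2 a, X a & C = [set b | X b /\ R a b]}.

Definition cls (T : Type) (X : set T) (R : T -> T -> Prop) (a : T)
    (Xa : X a) : quot X R :=
  exist _ [set b | X b /\ R a b] (ex_intro2 _ _ a Xa erefl).

Definition equivalence_on (T : Type) (X : set T) (R : T -> T -> Prop) : Prop :=
  [/\ forall a, X a -> R a a,
      forall a b, X a -> X b -> R a b -> R b a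
    & forall a b c, X a -> X b -> X c -> R a b -> R b c -> R a c].

Section CodeStructure.
Variables (LA LB : language) (G : code LA LB) (B : structure LB).
Variable p : 'I_(cpar G) -> B.

Definition dom : set ('I_(cdim G) -> B) := [set b | sat (cU G) (vcat b p)].

Definition sim (b b' : 'I_(cdim G) -> B) : Prop :=
  sat (cE G) (vcat (vcat b b') p).

Definition cst_def (c : cst LA) (b : 'I_(cdim G) -> B) : Prop :=
  sat (cC G c) (vcat b p).

Definition fct_def (f : fct LA) (b0 : 'I_(cdim G) -> B)
    (b : 'I_(fct_ar f) -> 'I_(cdim G) -> B) : Prop :=
  sat (cF G f) (vcat (vcat b0 (fun ij => b ij.1 ij.2)) p).

Definition prd_def (R : prd LA) (b : 'I_(prd_ar R) -> 'I_(cdim G) -> B) :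
    Prop :=
  sat (cR G R) (vcat (fun ij => b ij.1 ij.2) p).

Record well_defined : Prop := WellDefined {
  wd_dom : dom !=set0;
  wd_sim : equivalence_on dom sim;
  wd_cst : forall c, exists q : quot dom sim,
    forall b (Ub : dom b), cst_def c b <-> cls sim Ub = q;
  wd_fct : forall f, exists g : ('I_(fct_ar f) -> quot dom sim) -> quot dom sim,
    forall b0 (Ub0 : dom b0) b (Ub : forall i, dom (b i)),
      @fct_def f b0 b <-> cls sim Ub0 = g (fun i => cls sim (Ub i));
  wd_prd : forall R, exists r : ('I_(prd_ar R) -> quot dom sim) -> Prop,
    forall b (Ub : forall i, dom (b i)),
      @prd_def R b <-> r (fun i => cls sim (Ub i)) }.

Lemma wd_inh : well_defined -> inhabited (quot dom sim).
Proof. by case=> -[b Ub] _ _ _ _; exact: (inhabits (cls sim Ub)). Qed.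

(* The structure Γ(B,p). The constants, operations and relations picked here
   are the only ones with the properties in [well_defined]. *)
Definition code_structure (wd : well_defined) : structure LA :=
  @Structure LA (quot dom sim) (wd_inh wd)
    (fun c => projT1 (cid (wd_cst wd c)))
    (fun f => projT1 (cid (wd_fct wd f)))
    (fun R => projT1 (cid (wd_prd wd R))).

End CodeStructure.

Definition isomorphism (L : language) (M N : structure L) (h : M -> N) : Prop :=
  [/\ bijective h,
      forall c, h (icst M c) = icst N c,
      forall (f : fct L) (a : 'I_(fct_ar f) -> M),
        h (ifct a) = ifct (fun i => h (a i))
    & forall (R : prd L) (a : 'I_(prd_ar R) -> M),
        iprd a <-> iprd (fun i => h (a i))].

Definition is_interpretation (LA LB : language) (A : structure LA)
    (B : structure LB) (G : code LA LB) (p : 'I_(cpar G) -> B)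
    (mu : {b | dom p b} -> A) : Prop :=
  (forall a, exists b, mu b = a) /\
  exists (wd : well_defined p) (mubar : code_structure wd -> A),
    (forall b (Ub : dom p b), mubar (cls (sim p) Ub) = mu (exist _ b Ub)) /\
    isomorphism mubar.

Section Translation.
Variables (LA LB : language) (G : code LA LB).
Notation d := (cdim G).
Notation q := (cpar G).

(* The variables of ψ_Γ: each x in V becomes the tuple [inl (x, j)], j < dim Γ,
   and the [inr k] are the parameter variables. *)
Definition slot (V : Type) (x : V) (j : 'I_d) : V * 'I_d + 'I_q := inl (x, j).

Definition in_dom (V : Type) (x : V) : formula LB (V * 'I_d + 'I_q) :=
  fren (vcat (slot x) inr) (cU G).

Definition tr_atom (V : Type) (a : atom LA V) : formula LB (V * 'I_d + 'I_q) :=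
  match a with
  | AEq x x' => fren (vcat (vcat (slot x) (slot x')) inr) (cE G)
  | ACst x c => fren (vcat (slot x) inr) (cC G c)
  | AFun f xs x0 =>
      fren (vcat (vcat (slot x0) (fun ij => slot (xs ij.1) ij.2)) inr) (cF G f)
  | ARel R xs => fren (vcat (fun ij => slot (xs ij.1) ij.2) inr) (cR G R)
  end.

(* makes the tuple of variables replacing [None] the one bound by [exs], [alls] *)
Definition expose (V : Type) (x : option V * 'I_d + 'I_q) :
    V * 'I_d + 'I_q + 'I_d :=
  match x with
  | inl (Some y, j) => inl (inl (y, j))
  | inl (None, j) => inr j
  | inr k => inl (inr k)
  end.

Fixpoint tr_nform (V : Type) (phi : nform LA V) : formula LB (V * 'I_d + 'I_q) :=
  match phi with
  | NMat m => dnf_form (@tr_atom V) m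
  | NEx phi =>
      exs (fren (@expose V) (And (in_dom None) (tr_nform phi)))
  | NAll phi =>
      alls (fren (@expose V) (Imp (in_dom None) (tr_nform phi)))
  end.

(* ψ_Γ for ψ in normal form, V being the list of free variables of ψ *)
Definition translate (V : finType) (psi : nform LA V) :
    formula LB (V * 'I_d + 'I_q) :=
  foldr (fun x chi => And (in_dom x) chi) (tr_nform psi) (enum V).

(* Extended codes (Γ, p, γ). [translates w psi chi]: chi is ψ_{Γ,p,γ} for some
   choice of a normal form, the j-th variable replacing x being called [w x j].
   The equation for [psi] says that it is ψ(x_1,…,x_m,a_1,…,a_s) where the
   a_i are the parameters occurring in it. *)
Variables (A : structure LA) (B : structure LB).
Variables (p : 'I_q -> B) (gamma : A -> 'I_d -> B).

Definition plug (V W : Type) (w : V -> 'I_d -> W) (s : nat) (a : 'I_s -> A)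
    (x : (V + 'I_s) * 'I_d + 'I_q) : W + B :=
  match x with
  | inl (inl y, j) => inl (w y j)
  | inl (inr i, j) => inr (gamma (a i) j)
  | inr k => inr (p k)
  end.

Definition translates (V : finType) (W : Type) (w : V -> 'I_d -> W)
    (psi : pform A V) (chi : pform B W) : Prop :=
  exists (s : nat) (psi0 : formula LA (V + 'I_s)) (a : 'I_s -> A)
         (nu : nform LA (V + 'I_s)),
    [/\ injective a /\ (forall i, foccurs (a i) psi),
        psi = fname (vcat inl (fun i => inr (a i))) psi0,
        logically_equivalent psi0 (nform_form nu)
      & chi = fname (plug w a) (translate nu)].

(* Tuples in (B^d)^m are identified with tuples in B^(m * d). *)
Definition translates1 (m : nat) (psi : pform A 'I_m)
    (chi : pform B 'I_(m * d)) : Prop :=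
  translates (fun i j => mxvec_index i j) psi chi.

Definition translates2 (m s : nat) (psi : pform A ('I_m + 'I_s))
    (chi : pform B ('I_(m * d) + 'I_(s * d))) : Prop :=
  translates (fun x j => match x with
                         | inl i => inl (mxvec_index i j)
                         | inr i => inr (mxvec_index i j)
                         end) psi chi.

(* The normal form is chosen separately for each formula of S. *)
Definition translates_set (m : nat) (S : set (pform A 'I_m))
    (T : set (pform B 'I_(m * d))) : Prop :=
  exists2 tau : pform A 'I_m -> pform B 'I_(m * d),
    forall psi, S psi -> translates1 psi (tau psi) & T = tau @` S.

End Translation.

(* A cardinal is given by a type of that cardinality. *)
Inductive cardinal_bound := Card (K : Type) | Infty.

Definition smaller (T : Type) (S : set T) (k : cardinal_bound) : Prop :=
  match k with
  | Card K => (S #<= [set: K]) /\ ~ ([set: K] #<= S)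
  | Infty => True
  end.

Definition infinite_bound (k : cardinal_bound) : Prop :=
  match k with Card K => infinite_set [set: K] | Infty => True end.

Definition bound_le (k l : cardinal_bound) : Prop :=
  match k, l with
  | Card K, Card K' => [set: K] #<= [set: K']
  | Infty, Card _ => False
  | _, Infty => True
  end.

Section ProjectiveLogicalSets.
Variables (L : language) (A : structure L).

Definition logset (m : nat) (S : set (pform A 'I_m)) : set ('I_m -> A) :=
  [set a | forall psi, S psi -> psat psi a].

Definition system_bounded (alpha beta : cardinal_bound) (m : nat)
    (S : set (pform A 'I_m)) : Prop :=
  smaller S beta /\
  smaller [set a : A | exists2 psi, S psi & foccurs a psi] alpha.

(* E induces the formula equivalence R on X. So that equal equivalence
   relations on X are equal as Rocq terms, R is required to be false outside
   X × X. *)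
Definition induces_eqv (m : nat) (X : set ('I_m -> A))
    (R : ('I_m -> A) -> ('I_m -> A) -> Prop) (E : pform A ('I_m + 'I_m)) :
    Prop :=
  [/\ equivalence_on X R /\ (forall a a', R a a' -> X a /\ X a'),
      forall a a', X a -> X a' -> (R a a' <-> psat E (vcat a a'))
    & forall a a', X a -> psat E (vcat a a') \/ psat E (vcat a' a) -> X a'].

Record plset (m : nat) := PLSet {
  pl_set : set ('I_m -> A);
  pl_rel : ('I_m -> A) -> ('I_m -> A) -> Prop;
  pl_nonempty : pl_set !=set0;
  pl_logical : exists S, pl_set = logset S;
  pl_eqv : exists E, induces_eqv pl_set pl_rel E }.

Definition pl_quot (m : nat) (X : plset m) : Type :=
  quot (pl_set X) (@pl_rel m X).

Definition pl_cls (m : nat) (X : plset m) (a : 'I_m -> A) (Xa : pl_set X a) :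
    pl_quot X := cls (@pl_rel m X) Xa.

Definition induces_map (m s : nat) (X : plset m) (Y : plset s)
    (phi : pform A ('I_m + 'I_s)) (F : pl_quot X -> pl_quot Y) : Prop :=
  (forall a b (Xa : pl_set X a) (Yb : pl_set Y b),
     F (pl_cls Xa) = pl_cls Yb <-> psat phi (vcat a b)) /\
  (forall a b, pl_set X a -> ~ pl_set Y b -> ~ psat phi (vcat a b)).

Definition formula_map (m s : nat) (X : plset m) (Y : plset s) : Type :=
  {F : pl_quot X -> pl_quot Y | exists phi, induces_map phi F}.

(* ∃y (phi(x,y) ∧ psi(y,z)) *)
Definition fcompose (m s k : nat) (phi : pform A ('I_m + 'I_s))
    (psi : pform A ('I_s + 'I_k)) : pform A ('I_m + 'I_k) :=
  exs (And (fren (vcat (fun i => inl (inl i)) inr) phi)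
           (fren (vcat inr (fun i => inl (inr i))) psi)).

End ProjectiveLogicalSets.

Record category := Category {
  ob :> Type;
  hom : ob -> ob -> Type;
  idm : forall X, hom X X;
  cmp : forall X Y Z, hom X Y -> hom Y Z -> hom X Z;
  cmp_idl : forall X Y (f : hom X Y), cmp (idm X) f = f;
  cmp_idr : forall X Y (f : hom X Y), cmp f (idm Y) = f;
  cmp_assoc : forall X Y Z W (f : hom X Y) (g : hom Y Z) (h : hom Z W),
    cmp f (cmp g h) = cmp (cmp f g) h }.

Record functor (C D : category) := Functor {
  fob :> C -> D;
  fmor : forall X Y, hom X Y -> hom (fob X) (fob Y);
  fmor_id : forall X, fmor (idm X) = idm (fob X);
  fmor_cmp : forall X Y Z (f : hom X Y) (g : hom Y Z),
    fmor (cmp f g) = cmp (fmor f) (fmor g) }.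

Lemma functor_cmp_id (C D E : category) (F : functor C D) (G : functor D E)
    (X : C) : fmor G (fmor F (idm X)) = idm (G (F X)).
Proof. by rewrite !fmor_id. Qed.

Lemma functor_cmp_cmp (C D E : category) (F : functor C D) (G : functor D E)
    (X Y Z : C) (f : hom X Y) (g : hom Y Z) :
  fmor G (fmor F (cmp f g)) = cmp (fmor G (fmor F f)) (fmor G (fmor F g)).
Proof. by rewrite !fmor_cmp. Qed.

Definition functor_cmp (C D E : category) (F : functor C D) (G : functor D E) :
    functor C E :=
  @Functor C E (fun X => G (F X)) (fun X Y f => fmor G (fmor F f))
    (functor_cmp_id F G) (functor_cmp_cmp F G).

Definition faithful (C D : category) (F : functor C D) : Prop :=
  forall X Y : C, injective (@fmor C D F X Y).

Definition embedding (C D : category) (F : functor C D) : Prop :=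
  faithful F /\ injective F.

Definition full_sub (C : category) (P : C -> Prop) : category :=
  @Category {X : C | P X} (fun X Y => hom (sval X) (sval Y))
    (fun X => idm (sval X)) (fun X Y Z f g => cmp f g)
    (fun X Y f => cmp_idl f) (fun X Y f => cmp_idr f)
    (fun X Y Z W f g h => cmp_assoc f g h).

Definition inclusion (C : category) (P : C -> Prop) : functor (full_sub P) C :=
  @Functor (full_sub P) C sval (fun X Y f => f)
    (fun X => erefl) (fun X Y Z f g => erefl).

Definition arrow (C : category) : Type := {XY : C * C & hom XY.1 XY.2}.

Definition to_arrow (C : category) (X Y : C) (f : hom X Y) : arrow C :=
  existT (fun XY : C * C => hom XY.1 XY.2) (X, Y) f.

Lemma eval_tren (L : language) (M : structure L) (V W : Type) (r : V -> W)
    (t : term L V) (v : W -> M) :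
  eval v (tren r t) = eval (fun x => v (r x)) t.
Proof. by elim: t => //= f ts IH; congr ifct; apply: funext. Qed.

Lemma sat_fren (L : language) (M : structure L) (V : Type) (phi : formula L V) :
  forall (W : Type) (r : V -> W) (v : W -> M),
    sat (fren r phi) v <-> sat phi (fun x => v (r x)).
Proof.
have oE (V1 W1 : Type) (r : V1 -> W1) (v : W1 -> M) a :
  (fun x => oapp v a (omap r x)) = oapp (fun x => v (r x)) a.
  by apply: funext; case.
elim: phi => {V}.
- by move=> V t u W r v /=; rewrite !eval_tren.
- move=> V R ts W r v /=.
  by under eq_fun do rewrite eval_tren.
- by move=> V phi IH W r v /=; rewrite IH.
- by move=> V phi IH psi IH' W r v /=; rewrite IH IH'.
- by move=> V phi IH psi IH' W r v /=; rewrite IH IH'.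
- by move=> V phi IH psi IH' W r v /=; rewrite IH IH'.
- move=> V phi IH W r v /=.
  by split=> -[a Ha]; exists a; move: Ha; rewrite IH oE.
- move=> V phi IH W r v /=.
  by split=> H a; move: (H a); rewrite IH oE.
Qed.

Lemma sat_exs (L : language) (M : structure L) (V : Type) (n : nat) :
  forall (phi : formula L (V + 'I_n)) (v : V -> M),
    sat (exs phi) v <-> exists w : 'I_n -> M, sat phi (vcat v w).
Proof.
elim: n => [|n IH] phi v /=.
  rewrite sat_fren; split=> [H|[w H]].
    exists (no_ord M); congr (sat phi _): H.
    by apply: funext => -[x|[]].
  by congr (sat phi _): H; apply: funext => -[x|[]].
rewrite IH; split=> /= [[w [a]]|[w H]].
  rewrite sat_fren => H.
  exists (fun i => oapp w a (unlift ord0 i)); congr (sat phi _): H.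
  by apply: funext => -[x|i] //=; case: unlift.
exists (fun i => w (lift ord0 i)), (w ord0); rewrite sat_fren.
congr (sat phi _): H; apply: funext => -[x|i] //=.
by case: unliftP => [j ->|->].
Qed.

Section PLSCategory.
Variables (L : language) (A : structure L).

Lemma clsP (T : Type) (X : set T) (R : T -> T -> Prop) :
  equivalence_on X R -> forall a b (Xa : X a) (Xb : X b),
  cls R Xa = cls R Xb <-> R a b.
Proof.
case=> Rr Rs Rt a b Xa Xb; split=> [|Rab].
  move=> /(congr1 sval) /= abE.
  have: [set c | X c /\ R b c] b by split=> //; exact: Rr.
  by rewrite -abE => -[].
apply: eq_exist => /=; apply/seteqP; split=> c /= [Xc Rc]; split=> //.
  by apply: (Rt b a c) => //; exact: Rs.
exact: (Rt a b c).
Qed.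

Lemma clsE (T : Type) (X : set T) (R : T -> T -> Prop) (C : quot X R) :
  exists a (Xa : X a), C = cls R Xa.
Proof. by case: C => C [a Xa CE]; exists a, Xa; exact: eq_exist. Qed.

Lemma formula_map_id (m : nat) (X : plset A m) :
  exists phi, induces_map phi (@id (pl_quot X)).
Proof.
have [E [[Req _] RE EX]] := pl_eqv X.
exists E; split=> [a b Xa Xb|a b Xa nXb Eab].
  by rewrite -(RE _ _ Xa Xb); exact: clsP.
by apply: nXb; apply: (EX a b) => //; left.
Qed.

Lemma induces_fcompose (m s k : nat) (X : plset A m) (Y : plset A s)
    (Z : plset A k) phi psi (F : pl_quot X -> pl_quot Y)
    (H : pl_quot Y -> pl_quot Z) :
  induces_map phi F -> induces_map psi H ->
  induces_map (fcompose phi psi) (H \o F).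
Proof.
have compP a c : psat (fcompose phi psi) (vcat a c) <->
    exists b, psat phi (vcat a b) /\ psat psi (vcat b c).
  rewrite /psat /fcompose sat_exs; split=> -[b] /=.
    move=> -[]; rewrite !sat_fren => H1 H2; exists b; split.
      by congr (sat phi _): H1; apply: funext => -[].
    by congr (sat psi _): H2; apply: funext => -[].
  move=> [H1 H2]; exists b; rewrite !sat_fren; split.
    by congr (sat phi _): H1; apply: funext => -[].
  by congr (sat psi _): H2; apply: funext => -[].
move=> [F1 F2] [H1 H2]; split=> [a c Xa Zc|a c Xa nZc].
  rewrite compP; split=> [|[b [pab pbc]]].
    have [b [Yb Eb]] := clsE (F (pl_cls Xa)).
    rewrite /= Eb => HE; exists b; split; first exact/(F1 _ _ Xa Yb).
    exact/(H1 _ _ Yb Zc).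
  have [Yb|nYb] := pselect (pl_set Y b); last by case: (F2 a b).
  by rewrite /= ((F1 _ _ Xa Yb).2 pab); exact/H1.
rewrite compP => -[b [pab pbc]].
have [Yb|nYb] := pselect (pl_set Y b); last by case: (F2 a b).
by case: (H2 b c).
Qed.

Inductive plobj := PEmpty | PQuot (m : nat) (X : plset A m).

Definition plhom (O O' : plobj) : Type :=
  match O, O' with
  | PEmpty, _ => unit
  | PQuot _ _, PEmpty => void
  | PQuot _ X, PQuot _ Y => formula_map X Y
  end.

Definition plid (O : plobj) : plhom O O :=
  match O with
  | PEmpty => tt
  | PQuot m X => exist _ id (formula_map_id X)
  end.

Lemma formula_map_comp (m s k : nat) (X : plset A m) (Y : plset A s)
    (Z : plset A k) (F : formula_map X Y) (H : formula_map Y Z) :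
  exists phi, induces_map phi (sval H \o sval F).
Proof.
case: F H => [F [phi Fphi]] [H [psi Hpsi]].
by exists (fcompose phi psi); exact: induces_fcompose.
Qed.

Definition plcmp (O1 O2 O3 : plobj) : plhom O1 O2 -> plhom O2 O3 -> plhom O1 O3 :=
  match O1, O2, O3 return plhom O1 O2 -> plhom O2 O3 -> plhom O1 O3 with
  | PEmpty, _, _ => fun _ _ => tt
  | PQuot _ _, PEmpty, _ => fun f _ => of_void _ f
  | PQuot _ _, PQuot _ _, PEmpty => fun _ g => of_void _ g
  | PQuot _ X, PQuot _ Y, PQuot _ Z =>
      fun f g => exist _ (sval g \o sval f) (formula_map_comp f g)
  end.

Lemma plcmp_idl (O O' : plobj) (f : plhom O O') : plcmp (plid O) f = f.
Proof.
case: O O' f => [|m X] [|s Y] //=; try by case.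
by case=> f Hf; exact: eq_exist.
Qed.

Lemma plcmp_idr (O O' : plobj) (f : plhom O O') : plcmp f (plid O') = f.
Proof.
case: O O' f => [|m X] [|s Y] //=; try by case.
by case=> f Hf; exact: eq_exist.
Qed.

Lemma plcmp_assoc (O1 O2 O3 O4 : plobj) (f : plhom O1 O2) (g : plhom O2 O3)
    (h : plhom O3 O4) : plcmp f (plcmp g h) = plcmp (plcmp f g) h.
Proof.
case: O1 O2 O3 O4 f g h => [|m X] [|s Y] [|k Z] [|l W] //= f g h;
  try (by case: f); try (by case: g); try (by case: h).
exact: eq_exist.
Qed.

Definition PLS : category :=
  @Category plobj plhom plid plcmp plcmp_idl plcmp_idr plcmp_assoc.

Definition bounded_obj (alpha beta : cardinal_bound) (O : plobj) : Prop :=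
  match O with
  | PEmpty => True
  | PQuot m X => exists2 S, system_bounded alpha beta S & pl_set X = logset S
  end.

Definition PLSb (alpha beta : cardinal_bound) : category :=
  full_sub (C := PLS) (bounded_obj alpha beta).

Definition from_empty (O : PLS) : @hom PLS PEmpty O := tt.

Definition map_mor (m s : nat) (X : plset A m) (Y : plset A s)
    (f : formula_map X Y) : @hom PLS (PQuot X) (PQuot Y) := f.

End PLSCategory.

Section TranslationFunctor.
Variables (LA LB : language) (A : structure LA) (B : structure LB).
Variables (G : code LA LB) (p : 'I_(cpar G) -> B).
Variable gamma : A -> 'I_(cdim G) -> B.
Variables alpha beta : cardinal_bound.

Definition admissible (m : nat) (S : set (pform A 'I_m)) : Prop :=
  S !=set0 /\ system_bounded alpha beta S.

Definition trans_set (m : nat) (S : set (pform A 'I_m)) T : Prop :=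
  translates_set p gamma S T.

Definition trans2 (m s : nat) (phi : pform A ('I_m + 'I_s)) chi : Prop :=
  translates2 p gamma phi chi.

(* Xbar/∼ is obtained from X/∼ by translating the system S that defines X and
   the formula E that induces ∼ *)
Definition trans_obj_by (m : nat) (X : plset A m) (Xbar : plset B (m * cdim G))
    S T E Ebar : Prop :=
  [/\ pl_set X = logset S /\ induces_eqv (pl_set X) (@pl_rel _ _ _ X) E,
      trans_set S T, trans2 E Ebar
    & pl_set Xbar = logset T /\
      induces_eqv (pl_set Xbar) (@pl_rel _ _ _ Xbar) Ebar].

Definition trans_obj (m : nat) (X : plset A m) (Xbar : plset B (m * cdim G)) :
    Prop :=
  exists S T E Ebar, admissible S /\ trans_obj_by X Xbar S T E Ebar.

(* The existence of the (Γ,p,γ)-functor. Each of [trans_set] and [trans2]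
   stands for an arbitrary choice of normal forms, made anew each time. *)
Record functor_conditions : Prop := FunctorConditions {
  fc_empty : forall m (S : set (pform A 'I_m)) T,
    admissible S -> trans_set S T ->
    (logset S = set0 <-> logset T = set0);
  fc_set_ext : forall m (S S' : set (pform A 'I_m)) T T',
    admissible S -> admissible S' -> trans_set S T -> trans_set S' T' ->
    logset S = logset S' -> logset T = logset T';
  fc_eqv : forall m (S : set (pform A 'I_m)) T E Ebar,
    admissible S -> trans_set S T -> trans2 E Ebar -> logset S !=set0 ->
    (exists R, induces_eqv (logset S) R E) ->
    exists Rbar, induces_eqv (logset T) Rbar Ebar;
  fc_eqv_ext : forall m (S : set (pform A 'I_m)) T E E' Ebar E'bar,
    admissible S -> trans_set S T -> trans2 E Ebar -> trans2 E' E'bar ->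
    logset S !=set0 ->
    (exists R, induces_eqv (logset S) R E /\ induces_eqv (logset S) R E') ->
    exists Rbar, induces_eqv (logset T) Rbar Ebar /\
                 induces_eqv (logset T) Rbar E'bar;
  fc_map : forall m s (X : plset A m) (Y : plset A s) Xbar Ybar
      (phi : pform A ('I_m + 'I_s)) phibar,
    trans_obj X Xbar -> trans_obj Y Ybar -> trans2 phi phibar ->
    (exists f : pl_quot X -> pl_quot Y, induces_map phi f) ->
    exists fbar : pl_quot Xbar -> pl_quot Ybar, induces_map phibar fbar;
  fc_map_ext : forall m s (X : plset A m) (Y : plset A s) Xbar Ybar
      (phi phi' : pform A ('I_m + 'I_s)) phibar phi'bar,
    trans_obj X Xbar -> trans_obj Y Ybar ->
    trans2 phi phibar -> trans2 phi' phi'bar ->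
    (exists f : pl_quot X -> pl_quot Y,
       induces_map phi f /\ induces_map phi' f) ->
    exists fbar : pl_quot Xbar -> pl_quot Ybar,
      induces_map phibar fbar /\ induces_map phi'bar fbar;
  fc_comp : forall m s k (X : plset A m) (Y : plset A s) (Z : plset A k)
      Xbar Ybar Zbar
      (phi : pform A ('I_m + 'I_s)) (psi : pform A ('I_s + 'I_k))
      phibar psibar chibar
      (f : pl_quot X -> pl_quot Y) (g : pl_quot Y -> pl_quot Z)
      (fbar : pl_quot Xbar -> pl_quot Ybar)
      (gbar : pl_quot Ybar -> pl_quot Zbar),
    trans_obj X Xbar -> trans_obj Y Ybar -> trans_obj Z Zbar ->
    trans2 phi phibar -> trans2 psi psibar ->
    trans2 (fcompose phi psi) chibar ->
    induces_map phi f -> induces_map psi g ->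
    induces_map phibar fbar -> induces_map psibar gbar ->
    induces_map chibar (gbar \o fbar) }.

End TranslationFunctor.

Record is_interpretation_functor (LA LB : language) (A : structure LA)
    (B : structure LB) (G : code LA LB) (p : 'I_(cpar G) -> B)
    (gamma : A -> 'I_(cdim G) -> B) (F : functor (PLS A) (PLS B)) : Prop :=
IsInterpretationFunctor {
  if_exists : functor_conditions p gamma Infty Infty;
  if_empty : F (PEmpty A) = PEmpty B;
  if_obj : forall m (X : plset A m) S T E Ebar,
    S !=set0 -> pl_set X = logset S ->
    induces_eqv (pl_set X) (@pl_rel _ _ _ X) E ->
    trans_set p gamma S T -> trans2 p gamma E Ebar ->
    exists2 Xbar, trans_obj_by p gamma X Xbar S T E Ebar
                & F (PQuot X) = PQuot Xbar;
  if_from_empty : forall O : PLS A,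
    to_arrow (fmor F (from_empty O)) = to_arrow (from_empty (F O));
  if_map : forall m s (X : plset A m) (Y : plset A s) (f : formula_map X Y)
      phi phibar,
    induces_map phi (sval f) -> trans2 p gamma phi phibar ->
    exists Xbar Ybar (fbar : formula_map Xbar Ybar),
      [/\ trans_obj p gamma Infty Infty X Xbar,
          trans_obj p gamma Infty Infty Y Ybar,
          induces_map phibar (sval fbar)
        & to_arrow (fmor F (map_mor f)) = to_arrow (map_mor fbar)] }.

Definition restricts (LA LB : language) (A : structure LA) (B : structure LB)
    (F : functor (PLS A) (PLS B)) (alpha beta : cardinal_bound) : Prop :=
  exists F' : functor (PLSb A alpha beta) (PLSb B alpha beta),
    functor_cmp F' (inclusion (C := PLS B) (bounded_obj alpha beta)) =
    functor_cmp (inclusion (C := PLS A) (bounded_obj alpha beta)) F.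

(* Main.v *)
Require Import Defs.
From mathcomp Require Import all_boot all_algebra all_classical.

Set Implicit Arguments.
Unset Strict Implicit.
Unset Printing Implicit Defensive.

Local Open Scope classical_set_scope.
Local Open Scope card_scope.

(** Both halves of the theorem go through one notion, [coordinates]: a coordinate
    map h from tuples of B to A, extended by arbitrary values outside of the
    domain of the code, with a section gamma, such that the formulas of the code
    define the pullbacks along h of equality and of the constants, operations and
    relations of A. An interpretation is the same thing as such a map
    ([interpretation_coordinates], [coordinates_interpretation]).

    From coordinates to the functor. By induction on normal forms, a translated
    formula holds at a tuple t exactly when all the components of t lie in the
    domain of the code and the original formula holds at h(t)
    ([psat_translates]). So the normal form is immaterial, a logical set X defined
    by a non-empty system is sent to its pullback along h, and equivalence
    relations are pulled back too. The coordinate map then induces a bijection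
    between the quotient of the pullback and the quotient of X, and the action on
    formula maps is conjugation by these bijections. Functoriality, the seven
    conditions and faithfulness follow formally; injectivity on objects holds
    because h is surjective and because the number of variables m can be recovered
    from m * d, the dimension d being positive. For translations to exist at all,
    every formula must have a normal form ([normal_form_exists]) and must be
    obtained from a parameter-free formula by naming finitely many distinct
    elements ([extract_parameters]).

    The restriction to bounded systems. A translated system has at most as many
    formulas as the original one, and its parameters are the entries of gamma(a),
    for a among the original parameters, and the finitely many entries of p.
    Multiplying by d and adding a finite number does not lead out of an infinite
    cardinal bound ([smaller_copies]); this rests on the absorption law
    [card_leX_nat], which is obtained from Zorn's lemma.

    From the functor to coordinates. The first condition says that a system is
    unsolvable exactly when its translation is. The system of all inequations
    x <> a, for a in A, is unsolvable, so every tuple b in the domain of the code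
    is equivalent to gamma(a) for some a ([near_parameter]); call it h(b). It
    remains to see that the formulas of the code define the pullbacks along h of
    the relations of A. If an atom holds at (h(b_1), ..., h(b_n)), then the
    equations x_i = h(b_i) together with its negation are unsolvable; hence so are
    their translations, which leaves (b_1, ..., b_n) no choice but to satisfy the
    translated atom. The same argument applies to the negated atom
    ([atom_transfer]). *)

(** * Naming elements in formulas *)

Section Naming.
Variables (L : language) (A : structure L).

Lemma eval_tname (V W : Type) (r : W -> V + A) (t : term L W) (v : V -> A) :
  eval (M := expansion A) v (tname r t) = eval (fun x => vcat v id (r x)) t.
Proof.
elim: t => [x|c|f ts IH] //=; first by case: (r x).
by congr ifct; apply: funext => i; exact: IH.
Qed.

Lemma psat_fname (W : Type) (phi : formula L W) :
  forall (V : Type) (r : W -> V + A) (v : V -> A),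
    psat (fname r phi) v <-> sat phi (fun x => vcat v id (r x)).
Proof.
have liftE (V W' : Type) (r : W' -> V + A) (v : V -> A) a :
    (fun x => vcat (oapp v a) id (lift_name r x)) =
    oapp (fun x => vcat v id (r x)) a.
  by apply: funext => -[w|] //=; case: (r w).
rewrite /psat; elim: phi => {W}.
- by move=> W t u V r v /=; rewrite !eval_tname.
- move=> W R ts V r v /=.
  by under eq_fun do rewrite eval_tname.
- by move=> W phi IH V r v /=; rewrite IH.
- by move=> W phi IH psi IH' V r v /=; rewrite IH IH'.
- by move=> W phi IH psi IH' V r v /=; rewrite IH IH'.
- by move=> W phi IH psi IH' V r v /=; rewrite IH IH'.
- move=> W phi IH V r v /=.
  by split=> -[a Ha]; exists a; move: Ha; rewrite IH liftE.
- move=> W phi IH V r v /=.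
  by split=> H a; move: (H a); rewrite IH liftE.
Qed.

End Naming.

Section NamedElements.
Variables (L : language) (P : Type).

Lemma toccurs_tname (V W : Type) (r : W -> V + P) (t : term L W) b :
  toccurs b (tname r t) -> exists x, r x = inr b.
Proof.
elim: t => [x|c|f ts IH] //=; last by case=> i /IH.
by case E: (r x) => //= ->; exists x.
Qed.

Lemma foccurs_fname (W : Type) (phi : formula L W) :
  forall (V : Type) (r : W -> V + P) b,
    foccurs b (fname r phi) -> exists x, r x = inr b.
Proof.
have liftP (V W' : Type) (r : W' -> V + P) b :
    (exists x, lift_name r x = inr b) -> exists x, r x = inr b.
  by case=> -[w|] //=; case E: (r w) => [//|c] [<-]; exists w.
elim: phi => {W} /=.
- by move=> W t u V r b [] /toccurs_tname.
- by move=> W R ts V r b [i] /toccurs_tname.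
- by move=> W phi IH V r b /IH.
- by move=> W phi IH psi IH' V r b [/IH|/IH'].
- by move=> W phi IH psi IH' V r b [/IH|/IH'].
- by move=> W phi IH psi IH' V r b [/IH|/IH'].
- by move=> W phi IH V r b /IH/liftP.
- by move=> W phi IH V r b /IH/liftP.
Qed.

(** True because arities are finite. *)
Lemma finite_toccurs (V : Type) (t : term (lang_with L P) V) :
  finite_set [set a | toccurs a t].
Proof.
elim: t => [x|[c|a]|f ts IH] /=.
- exact: finite_set0.
- exact: finite_set0.
- exact: finite_set1.
- rewrite [X in finite_set X](_ : _ =
      \bigcup_(i in setT) [set a | toccurs a (ts i)]); first exact: bigcup_finite.
  by apply/seteqP; split=> a [i]; [exists i|move=> _; exists i].
Qed.

Lemma finite_foccurs (V : Type) (phi : formula (lang_with L P) V) :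
  finite_set [set a | foccurs a phi].
Proof.
have finU (X Y : set P) :
    finite_set X -> finite_set Y -> finite_set [set a | X a \/ Y a].
  by move=> Xf Yf; change (finite_set (X `|` Y)); rewrite finite_setU.
elim: phi => {V} //=.
- by move=> V t u; apply: finU; exact: finite_toccurs.
- move=> V R ts.
  rewrite [X in finite_set X](_ : _ =
      \bigcup_(i in setT) [set a | toccurs a (ts i)]).
    by apply: bigcup_finite => // i _; exact: finite_toccurs.
  by apply/seteqP; split=> a [i]; [exists i|move=> _; exists i].
- by move=> V phi IH psi IH'; exact: finU.
- by move=> V phi IH psi IH'; exact: finU.
- by move=> V phi IH psi IH'; exact: finU.
Qed.

Lemma finite_injection (X : set P) : finite_set X ->
  exists (s : nat) (a : 'I_s -> P),
    injective a /\ forall x, X x <-> exists i, a i = x.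
Proof.
case/(@finite_seqP {classic P}) => l ->; exists (size (undup l)).
exists (fun i => tnth (in_tuple (undup l)) i : P); split=> [|x].
  exact/(@tuple_uniqP _ _ (in_tuple (undup l)))/undup_uniq.
by rewrite /= -mem_undup; split=> [/(tnthP (in_tuple _))[i ->]|[i <-]];
  [exists i|exact: (mem_tnth i (in_tuple (undup l)))].
Qed.

Lemma tname_surj (V W : Type) (r : W -> V + P) (t : term (lang_with L P) V) :
  (forall x, exists w, r w = inl x) ->
  (forall a, toccurs a t -> exists w, r w = inr a) ->
  exists t0 : term L W, t = tname r t0.
Proof.
move=> rV; elim: t => [x|[c|a]|f ts IH] /= rP.
- by have [w rw] := rV x; exists (Var w); rewrite /= rw.
- by exists (Cst c).
- by have [w rw] := rP a erefl; exists (Var w); rewrite /= rw.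
- have /choice[ts0 ts0E] : forall i, exists t0 : term L W, ts i = tname r t0.
    by move=> i; apply: IH => a ta; apply: rP; exists i.
  by exists (@App L W f ts0) => /=; congr App; apply: funext.
Qed.

(** The new constants are turned back into variables. Stating this for every
    naming r that reaches all the variables and all the new constants in use,
    rather than for the one of [extract_parameters], makes the hypotheses stable
    under [lift_name], so that the induction passes through quantifiers. *)
Lemma fname_surj (V : Type) (phi : formula (lang_with L P) V) :
  forall (W : Type) (r : W -> V + P),
  (forall x, exists w, r w = inl x) ->
  (forall a, foccurs a phi -> exists w, r w = inr a) ->
  exists phi0 : formula L W, phi = fname r phi0.
Proof.
have liftV (V' W : Type) (r : W -> V' + P) :
    (forall x, exists w, r w = inl x) ->
    forall x, exists w, lift_name r w = inl x.
  move=> rV [x|]; last by exists None.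
  by have [w rw] := rV x; exists (Some w); rewrite /= rw.
have liftP (V' W : Type) (r : W -> V' + P) a :
    (exists w, r w = inr a) -> exists w, lift_name r w = inr a.
  by case=> w rw; exists (Some w); rewrite /= rw.
elim: phi => {V} /=.
- move=> V t u W r rV rP.
  have [|t0 ->] := tname_surj (t := t) rV.
    by move=> a ta; apply: rP; left.
  have [|u0 ->] := tname_surj (t := u) rV.
    by move=> a ta; apply: rP; right.
  by exists (Eq t0 u0).
- move=> V R ts W r rV rP.
  have /choice[ts0 ts0E] : forall i, exists t0 : term L W, ts i = tname r t0.
    by move=> i; apply: (tname_surj rV) => a ta; apply: rP; exists i.
  by exists (@Rel L W R ts0) => /=; congr Rel; apply: funext.
- move=> V phi IH W r rV rP; have [phi0 ->] := IH _ _ rV rP.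
  by exists (Neg phi0).
- move=> V phi IH psi IH' W r rV rP.
  have [|phi0 ->] := IH _ _ rV; first by move=> a ta; apply: rP; left.
  have [|psi0 ->] := IH' _ _ rV; first by move=> a ta; apply: rP; right.
  by exists (And phi0 psi0).
- move=> V phi IH psi IH' W r rV rP.
  have [|phi0 ->] := IH _ _ rV; first by move=> a ta; apply: rP; left.
  have [|psi0 ->] := IH' _ _ rV; first by move=> a ta; apply: rP; right.
  by exists (Or phi0 psi0).
- move=> V phi IH psi IH' W r rV rP.
  have [|phi0 ->] := IH _ _ rV; first by move=> a ta; apply: rP; left.
  have [|psi0 ->] := IH' _ _ rV; first by move=> a ta; apply: rP; right.
  by exists (Imp phi0 psi0).
- move=> V phi IH W r rV rP.
  have [|phi0 ->] := IH _ _ (liftV _ _ _ rV); first by move=> a /rP/liftP.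
  by exists (Ex phi0).
- move=> V phi IH W r rV rP.
  have [|phi0 ->] := IH _ _ (liftV _ _ _ rV); first by move=> a /rP/liftP.
  by exists (All phi0).
Qed.

Lemma extract_parameters (V : Type) (psi : formula (lang_with L P) V) :
  exists (s : nat) (psi0 : formula L (V + 'I_s)) (a : 'I_s -> P),
    [/\ injective a, forall i, foccurs (a i) psi
      & psi = fname (vcat inl (fun i => inr (a i))) psi0].
Proof.
have [s [a [a_inj aP]]] := finite_injection (finite_foccurs psi).
have [x|b /aP[i <-]|psi0 psiE] :=
    @fname_surj V psi (V + 'I_s) (vcat inl (fun i => inr (a i))).
- by exists (inl x).
- by exists (inr i).
- by exists s, psi0, a; split=> // i; apply/aP; exists i.
Qed.

End NamedElements.

(** * Normal forms *)

Section NormalForms.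
Variable L : language.

Section Matrices.
Variable V : Type.
Local Notation csat c := (sat (conj_form (@atom_form L V) c)).
Local Notation dsat d := (sat (dnf_form (@atom_form L V) d)).

Lemma conj_and (c c' : conjunction L V) :
  exists c2, forall (M : structure L) (v : V -> M),
    csat c2 v <-> csat c v /\ csat c' v.
Proof.
elim: c => [l|l c [c2 c2E]]; first by exists (ConjCons l c').
by exists (ConjCons l c2) => M v /=; rewrite c2E; tauto.
Qed.

Lemma dnf_or (d d' : dnf L V) :
  exists d2, forall (M : structure L) (v : V -> M),
    dsat d2 v <-> dsat d v \/ dsat d' v.
Proof.
elim: d => [c|c d [d2 d2E]]; first by exists (DnfCons c d').
by exists (DnfCons c d2) => M v /=; rewrite d2E; tauto.
Qed.

Lemma dnf_and (d d' : dnf L V) :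
  exists d2, forall (M : structure L) (v : V -> M),
    dsat d2 v <-> dsat d v /\ dsat d' v.
Proof.
have conj_dnf c (e : dnf L V) :
    exists e2, forall (M : structure L) (v : V -> M),
    dsat e2 v <-> csat c v /\ dsat e v.
  elim: e => [c'|c' e [e2 e2E]]; have [c2 c2E] := conj_and c c'.
    by exists (DnfOne c2).
  by exists (DnfCons c2 e2) => M v /=; rewrite c2E e2E; tauto.
elim: d => [c|c d [d2 d2E]]; first exact: conj_dnf.
have [e eE] := conj_dnf c d'; have [e2 e2E] := dnf_or e d2.
by exists e2 => M v /=; rewrite e2E eE d2E; tauto.
Qed.

Lemma dnf_neg (d : dnf L V) :
  exists d2, forall (M : structure L) (v : V -> M),
    dsat d2 v <-> ~ dsat d v.
Proof.
have lit_neg (l : literal L V) :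
    exists l2, forall (M : structure L) (v : V -> M),
    sat (literal_form (@atom_form L V) l2) v <->
    ~ sat (literal_form (@atom_form L V) l) v.
  by case: l => a; [exists (Opp a)|exists (Pos a)] => M v //=; rewrite notK.
have conj_neg c :
    exists e, forall (M : structure L) (v : V -> M), dsat e v <-> ~ csat c v.
  elim: c => [l|l c [e eE]]; have [l2 l2E] := lit_neg l.
    by exists (DnfOne (ConjOne l2)).
  exists (DnfCons (ConjOne l2) e) => M v /=.
  by rewrite l2E eE not_andP.
elim: d => [c|c d [d2 d2E]]; have [e eE] := conj_neg c.
  by exists e.
have [e2 e2E] := dnf_and e d2.
by exists e2 => M v /=; rewrite e2E eE d2E not_orP.
Qed.

End Matrices.

Lemma dnf_rename (V W : Type) (r : V -> W) (d : dnf L V) :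
  exists d2, forall (M : structure L) (v : W -> M),
    sat (dnf_form (@atom_form L W) d2) v <->
    sat (dnf_form (@atom_form L V) d) (fun x => v (r x)).
Proof.
have lit_ren (l : literal L V) :
    exists l2, forall (M : structure L) (v : W -> M),
    sat (literal_form (@atom_form L W) l2) v <->
    sat (literal_form (@atom_form L V) l) (fun x => v (r x)).
  have atom_ren (a : atom L V) :
      exists a2, forall (M : structure L) (v : W -> M),
      sat (atom_form a2) v <-> sat (atom_form a) (fun x => v (r x)).
    case: a => [x x'|x c|f xs x0|R xs].
    - by exists (AEq L (r x) (r x')).
    - by exists (ACst (r x) c).
    - by exists (AFun (fun i => r (xs i)) (r x0)).
    - by exists (ARel (fun i => r (xs i))).
  by case: l => a; have [a2 a2E] := atom_ren a;
    [exists (Pos a2)|exists (Opp a2)] => M v /=; rewrite a2E.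
have conj_ren c : exists c2, forall (M : structure L) (v : W -> M),
    sat (conj_form (@atom_form L W) c2) v <->
    sat (conj_form (@atom_form L V) c) (fun x => v (r x)).
  elim: c => [l|l c [c2 c2E]]; have [l2 l2E] := lit_ren l.
    by exists (ConjOne l2).
  by exists (ConjCons l2 c2) => M v /=; rewrite l2E c2E.
elim: d => [c|c d [d2 d2E]]; have [c2 c2E] := conj_ren c.
  by exists (DnfOne c2).
by exists (DnfCons c2 d2) => M v /=; rewrite c2E d2E.
Qed.

(** Normal forms are replaced by the properties of assignments that they
    express, uniformly in the structure. It is then enough to show that these
    properties are closed under the logical operations, and no syntactic prenex
    transformation has to be defined. *)
Definition nf_definable (V : Type)
    (Q : forall M : structure L, (V -> M) -> Prop) : Prop :=
  exists nu : nform L V, forall M v, sat (nform_form nu) v <-> Q M v.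

Lemma nf_eq (V : Type) (Q Q' : forall M : structure L, (V -> M) -> Prop) :
  (forall M v, Q M v <-> Q' M v) -> nf_definable Q -> nf_definable Q'.
Proof. by move=> QQ' [nu nuE]; exists nu => M v; rewrite nuE. Qed.

Lemma nf_atom (V : Type) (a : atom L V) :
  nf_definable (fun M v => sat (M := M) (atom_form a) v).
Proof. by exists (NMat (DnfOne (ConjOne (Pos a)))). Qed.

Lemma nf_ex (V : Type) (Q : forall M : structure L, (option V -> M) -> Prop) :
  nf_definable Q -> nf_definable (fun M v => exists a, Q M (oapp v a)).
Proof.
case=> nu nuE; exists (NEx nu) => M v /=.
by split=> -[a Qa]; exists a; apply/nuE.
Qed.

Lemma nf_all (V : Type) (Q : forall M : structure L, (option V -> M) -> Prop) :
  nf_definable Q -> nf_definable (fun M v => forall a, Q M (oapp v a)).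
Proof.
case=> nu nuE; exists (NAll nu) => M v /=.
by split=> Qa a; apply/nuE.
Qed.

Lemma nf_neg (V : Type) (Q : forall M : structure L, (V -> M) -> Prop) :
  nf_definable Q -> nf_definable (fun M v => ~ Q M v).
Proof.
case=> nu nuE; suff: nf_definable (fun M v => ~ sat (M := M) (nform_form nu) v).
  by apply: nf_eq => M v; rewrite nuE.
elim: nu {Q nuE} => {V} [V d|V nu IH|V nu IH] /=.
- by have [d2 d2E] := dnf_neg d; exists (NMat d2).
- by apply: nf_eq (nf_all IH) => M v; rewrite forallNP.
- by apply: nf_eq (nf_ex IH) => M v; rewrite existsNP.
Qed.

Lemma nf_rename (V W : Type) (r : V -> W)
    (Q : forall M : structure L, (V -> M) -> Prop) :
  nf_definable Q -> nf_definable (fun M v => Q M (fun x => v (r x))).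
Proof.
case=> nu nuE.
suff: nf_definable (fun (M : structure L) (v : W -> M) =>
    sat (nform_form nu) (fun x => v (r x))).
  by apply: nf_eq => M v; rewrite nuE.
have oE (V1 W1 : Type) (r1 : V1 -> W1) (M : structure L) (v : W1 -> M) a :
    (fun x => oapp v a (omap r1 x)) = oapp (fun x => v (r1 x)) a.
  by apply: funext; case.
elim: nu W r {Q nuE} => {V} [V d|V nu IH|V nu IH] W r /=.
- by have [d2 d2E] := dnf_rename r d; exists (NMat d2).
- apply: nf_eq (nf_ex (IH _ (omap r))) => M v.
  by split=> -[a Qa]; exists a; rewrite oE in Qa *.
- apply: nf_eq (nf_all (IH _ (omap r))) => M v.
  by split=> Qa a; have := Qa a; rewrite oE.
Qed.

(** Quantifiers are pulled out of a conjunction one at a time, first those of the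
    left conjunct. For the universal ones this uses that structures are
    non-empty. *)
Lemma nf_and (V : Type) (Q Q' : forall M : structure L, (V -> M) -> Prop) :
  nf_definable Q -> nf_definable Q' ->
  nf_definable (fun M v => Q M v /\ Q' M v).
Proof.
case=> nu nuE.
suff: nf_definable Q' ->
    nf_definable (fun M v => sat (M := M) (nform_form nu) v /\ Q' M v).
  by move=> H /H; apply: nf_eq => M v; rewrite nuE.
elim: nu Q' {Q nuE} => {V} [V d|V nu IH|V nu IH] Q' /=.
- case=> nu' nu'E.
  suff: nf_definable (fun (M : structure L) (v : V -> M) =>
      sat (dnf_form (@atom_form L V) d) v /\ sat (nform_form nu') v).
    by apply: nf_eq => M v; rewrite nu'E.
  elim: nu' d {Q' nu'E} => {V} [V d'|V nu' IH|V nu' IH] d /=.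
  + by have [d2 d2E] := dnf_and d d'; exists (NMat d2).
  + have [d2 d2E] := dnf_rename some d.
    apply: nf_eq (nf_ex (IH d2)) => M v.
    split=> [[a []]|[Hd [a Ha]]]; first by rewrite d2E; split=> //; exists a.
    by exists a; rewrite d2E.
  + have [d2 d2E] := dnf_rename some d.
    apply: nf_eq (nf_all (IH d2)) => M v.
    split=> [H|[Hd H] a]; last by rewrite d2E.
    split=> [|a]; last by case: (H a).
    by case: (carrier_inh M) => a; case: (H a); rewrite d2E.
- move=> /(nf_rename some)/IH/nf_ex; apply: nf_eq => M v.
  by split=> [[a [Ha ?]]|[[a Ha] ?]]; [split=> //; exists a|exists a].
- move=> /(nf_rename some)/IH/nf_all; apply: nf_eq => M v.
  split=> [H|[H ?] a]; last by split.
  split=> [a|]; first by case: (H a).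
  by case: (carrier_inh M) => a; case: (H a).
Qed.

Lemma nf_exs (V : Type) (n : nat)
    (Q : forall M : structure L, (V + 'I_n -> M) -> Prop) :
  nf_definable Q ->
  nf_definable (fun M v => exists w : 'I_n -> M, Q M (vcat v w)).
Proof.
elim: n Q => [|n IH] Q.
  move=> /(nf_rename (vcat id (no_ord V))); apply: nf_eq => M v.
  have E (w : 'I_0 -> M) : vcat v w = fun x => v (vcat id (no_ord V) x).
    by apply: funext => -[x|[]].
  by split=> [|[w]]; rewrite ?E //; exists (no_ord M); rewrite E.
move=> /(nf_rename (@push n V))/nf_ex/IH; apply: nf_eq => M v; split.
  case=> w [a Qa]; exists (fun i => oapp w a (unlift ord0 i)).
  by congr (Q M): Qa; apply: funext => -[x|i] //=; case: unlift.
case=> w Qw; exists (fun i => w (lift ord0 i)), (w ord0).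
congr (Q M): Qw; apply: funext => -[x|i] //=.
by case: unliftP => [j ->|->].
Qed.

(** The extra conjunct Q0 is there because an empty conjunction need not be
    expressible by a matrix: without variables there are no atoms. *)
Lemma nf_and_all (V : Type) (n : nat)
    (Q : 'I_n -> forall M : structure L, (V -> M) -> Prop) Q0 :
  (forall i, nf_definable (Q i)) -> nf_definable Q0 ->
  nf_definable (fun M v => (forall i, Q i M v) /\ Q0 M v).
Proof.
move=> Qd Q0d.
have: nf_definable (fun M v =>
    (forall i, i \in enum 'I_n -> Q i M v) /\ Q0 M v).
  elim: (enum 'I_n) => [|j l IH].
    by apply: nf_eq Q0d => M v; split=> [//|[]].
  apply: nf_eq (nf_and (Qd j) IH) => M v.
  split=> [[Qj [Ql Q0v]]|[Ql Q0v]].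
    by split=> // i; rewrite inE => /orP[/eqP->|/Ql].
  split; first by apply: Ql; rewrite mem_head.
  by split=> // i il; apply: Ql; rewrite inE il orbT.
apply: nf_eq => M v; split=> -[Qv Q0v]; split=> // i.
by apply: Qv; rewrite mem_enum.
Qed.

(** Unnesting: the graph of a term is defined by giving names to the values of
    its immediate subterms. *)
Lemma nf_term (V : Type) (t : term L V) : forall (W : Type) (r : V -> W) y,
  nf_definable (fun M v => eval (M := M) (fun x => v (r x)) t = v y).
Proof.
elim: t => [x|c|f ts IH] W r y /=.
- exact: nf_eq (nf_atom (AEq L (r x) y)).
- by apply: nf_eq (nf_atom (ACst y c)) => M v /=; split=> ->.
have graph := nf_exs (nf_and_all
  (fun i => IH i _ (fun x => inl (r x)) (inr i))
  (nf_atom (@AFun L (W + 'I_(fct_ar f)) f inr (inl y)))).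
apply: nf_eq graph => M v /=; split=> [[w [ww <-]]|<-].
  by congr ifct; apply: funext => i; rewrite ww.
by exists (fun i => eval (fun x => v (r x)) (ts i)).
Qed.

Lemma nf_formula (V : Type) (phi : formula L V) :
  nf_definable (fun M v => sat (M := M) phi v).
Proof.
elim: phi => {V} /=.
- move=> V t u.
  apply: nf_eq (nf_ex (nf_and (nf_term t some None) (nf_term u some None))).
  move=> M v; split=> [[a /= [-> ->]]|tu] //.
  by exists (eval v t).
- move=> V R ts.
  have graph := nf_exs (nf_and_all (fun i => nf_term (ts i) inl (inr i))
    (nf_atom (@ARel L (V + 'I_(prd_ar R)) R inr))).
  apply: nf_eq graph => M v /=; split=> [[w [ww Rw]]|Rt].
    by congr iprd: Rw; apply: funext => i; rewrite ww.
  by exists (fun i => eval v (ts i)).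
- by move=> V phi /nf_neg.
- by move=> V phi IH psi /(nf_and IH).
- move=> V phi IH psi IH'.
  apply: nf_eq (nf_neg (nf_and (nf_neg IH) (nf_neg IH'))) => M v.
  by rewrite -not_orP notK.
- move=> V phi IH psi IH'.
  apply: nf_eq (nf_neg (nf_and IH (nf_neg IH'))) => M v.
  by rewrite -not_implyP notK.
- by move=> V phi /nf_ex.
- by move=> V phi /nf_all.
Qed.

Lemma normal_form_exists (V : Type) (phi : formula L V) :
  exists nu : nform L V, logically_equivalent phi (nform_form nu).
Proof. by have [nu nuE] := nf_formula phi; exists nu => M v; rewrite nuE. Qed.

End NormalForms.

(** * Absorption for infinite cardinals *)

(** A maximal disjoint family of countably infinite subsets of X leaves out only
    finitely many points. Adding these to one of the members, X is covered by
    countable sets, each indexed by an infinite set of its own; numbering the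
    latter by pairs maps X onto X x nat. *)
Lemma card_leX_nat (T : Type) (X : set T) :
  infinite_set X -> X `*` [set: nat] #<= X.
Proof.
elim/Ppointed: T => T in X *.
  by rewrite emptyE => X0; case: X0; exact: finite_set0.
move=> Xinf; have [x0 Xx0] := infinite_setN0 Xinf.
pose D := [set C : set T | C `<=` X /\ C #= [set: nat]].
have [E [ED Edisj Emax]] := ex_maximal_disjoint_subcollection id D.
pose rest := X `\` \bigcup_(C in E) C.
have rest_fin : finite_set rest.
  apply: contrapT => /infiniteP/pcard_leP[f].
  pose C := f @` [set: nat].
  have CX : C `<=` rest by move=> _ [n _ <-]; exact: funS.
  have CN : C #= [set: nat] by apply: card_image.
  have C0 : C !=set0 by exists (f 0%N), 0%N.
  have nEC : ~ E C.
    by move=> EC; case: C0 => x Cx; have [_] := CX _ Cx; apply; exists C.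
  apply: (Emax (E `|` [set C])).
  - split=> [|/(_ C (or_intror erefl))//]; exact: subsetUl.
  - by move=> _ [/ED//|->]; split=> // x /CX[].
  move=> C1 C2 [E1|->] [E2|->] //.
  - exact: Edisj.
  - by case=> x [C1x /CX[_ []]]; exists C1.
  - by case=> x [/CX[_ nx] C2x]; case: nx; exists C2.
have [C0 EC0] : E !=set0.
  apply: contrapT => /set0P/negP/negPn/eqP E0; apply: Xinf.
  by move: rest_fin; rewrite /rest E0 bigcup_set0 setD0.
pose F C := C `|` (if pselect (C = C0) then rest else set0).
have FX x : X x -> exists2 C, E C & F C x.
  move=> Xx; have [[C EC Cx]|nx] := pselect ((\bigcup_(C in E) C) x).
    by exists C => //; left.
  by exists C0 => //; right; case: pselect.
(* [num] numbers C by pairs (k, n), and [enu] enumerates F C *)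
have coverC C : exists phi : T -> T * nat,
    E C -> F C `*` [set: nat] `<=` phi @` C.
  have [EC|nEC] := pselect (E C); last by exists (fun x => (x, 0%N)).
  have [CX CN] := ED _ EC.
  have [num numP] : exists num : T -> nat * nat, [set: nat * nat] `<=` num @` C.
    apply/(@pcard_surjP (nat * nat)%type).
    by rewrite (card_le_eqr CN) (card_le_eql card_nat2) card_lexx.
  have [enu enuP] : exists enu : nat -> T, F C `<=` enu @` [set: nat].
    apply/(@pcard_surjP T).
    have -> : F C = \bigcup_(b in [set: bool]) if b then C
               else if pselect (C = C0) then rest else set0.
      apply/seteqP; split=> x; first by case=> ?; [exists true|exists false].
      by case=> -[] _ ?; [left|right].
    apply: bigcup_countable; [exact: countableP|case=> _ /=].
      by rewrite /countable (card_le_eql CN) card_lexx.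
    by case: pselect => ?; [exact: finite_set_countable|exact: countable0].
  exists (fun x => (enu (num x).1, (num x).2)) => _ [x n] /= [/enuP[k _ <-] _].
  by have [y Cy numy] := numP (k, n) I; exists y; rewrite // numy.
have [phi phiP] := choice coverC.
have owner x : exists C, (\bigcup_(C in E) C) x -> E C /\ C x.
  have [[C EC Cx]|nx] := pselect ((\bigcup_(C in E) C) x); last by exists C0.
  by exists C.
have [own ownP] := choice owner.
have sub : X `*` [set: nat] `<=` (fun x => phi (own x) x) @` X.
  move=> [y n] [/FX[C EC Cy] _].
  have [x Cx phix] := phiP C EC (y, n) (conj Cy I).
  have [Eown ownx] : E (own x) /\ own x x by apply: ownP; exists C.
  have ownE : own x = C by apply: Edisj => //; exists x.
  by exists x; [case: (ED _ EC) => CX _; exact: CX|rewrite /= ownE].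
exact: card_le_trans (subset_card_le sub) (card_image_le _ _).
Qed.

(** If X is finite, so is Y, and any infinite bound will do; if X is infinite, Y
    is an image of X x nat, which is no larger than X. *)
Lemma smaller_copies (T U : Type) (X : set T) (Y : set U) (k : cardinal_bound)
    (n m : nat) (f : T -> 'I_n -> U) (g : 'I_m -> U) :
  infinite_bound k -> smaller X k ->
  (forall y, Y y ->
     (exists2 x, X x & exists j, y = f x j) \/ exists i, y = g i) ->
  smaller Y k.
Proof.
case: k => [K|] //= Kinf [XK KX] Ycov.
have Yfin : finite_set X -> finite_set Y.
  move=> Xfin; have cov : Y `<=` (\bigcup_(x in X) f x @` setT) `|` g @` setT.
    move=> y /Ycov[[x Xx [j ->]]|[i ->]]; last by right; exists i.
    by left; exists x => //; exists j.
  apply: sub_finite_set cov _; rewrite finite_setU; split.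
    apply: bigcup_finite => // x _.
    by apply: finite_image; exact: finite_finset.
  by apply: finite_image; exact: finite_finset.
have [Xfin|Xinf] := pselect (finite_set X).
  have {}Yfin := Yfin Xfin; split; last by move=> /card_le_finite/(_ Yfin).
  exact: card_le_trans (finite_set_countable Yfin) ((infiniteP _).1 Kinf).
suff YX : Y #<= X.
  split; first exact: card_le_trans YX XK.
  by move=> KY; apply: KX; exact: card_le_trans KY YX.
apply: card_le_trans (card_leX_nat Xinf).
(* the copy of x numbered k < n yields f x k, and for k >= n it yields the
   isolated point number k - n, whatever x is *)
pose h (xk : T * nat) : set U :=
  [set y | (exists2 j : 'I_n, xk.2 = j & y = f xk.1 j) \/
           (exists2 i : 'I_m, xk.2 = n + i & y = g i)].
have [x0 Xx0] := infinite_setN0 Xinf.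
have [Y0|/set0P[y0 _]] := eqVneq Y set0; first by rewrite Y0 card_ge0.
have hP xk : exists y, forall y', h xk y' -> y' = y.
  case: (pselect (h xk !=set0)) => [[y hy]|h0]; last first.
    by exists y0 => y' hy'; case: h0; exists y'.
  exists y => y'; case: hy => -[i xki ->] [] [i' xki' ->].
  - by congr f; apply: val_inj; rewrite /= -xki -xki'.
  - by have := ltn_ord i; rewrite -xki xki' ltnNge leq_addr.
  - by have := ltn_ord i'; rewrite -xki' xki ltnNge leq_addr.
  - congr g; apply: val_inj; apply/eqP.
    by rewrite -(eqn_add2l n) /= -xki -xki'.
have [h' h'P] := choice hP.
have cov : Y `<=` h' @` (X `*` [set: nat]).
  move=> y /Ycov[[x Xx [j ->]]|[i ->]].
    exists (x, j : nat); first by split.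
    by apply/esym/h'P; left; exists j.
  exists (x0, n + i); first by split.
  by apply/esym/h'P; right; exists i.
exact: card_le_trans (subset_card_le cov) (card_image_le _ _).
Qed.

(** * The semantics of translated formulas *)

Lemma sat_alls (L : language) (M : structure L) (V : Type) (n : nat) :
  forall (phi : formula L (V + 'I_n)) (v : V -> M),
    sat (alls phi) v <-> forall w : 'I_n -> M, sat phi (vcat v w).
Proof.
elim: n => [|n IH] phi v /=.
  have E (w : 'I_0 -> M) : vcat v w = fun x => v (vcat id (no_ord V) x).
    by apply: funext => -[x|[]].
  by rewrite sat_fren; split=> [H w|/(_ (no_ord M))]; rewrite E.
rewrite IH; split=> H w.
  have /= /(_ (w ord0)) := H (fun i => w (lift ord0 i)); rewrite sat_fren.
  congr (sat phi _); apply: funext => -[x|i] //=.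
  by case: unliftP => [j ->|->].
move=> a; rewrite sat_fren; have := H (fun i => oapp w a (unlift ord0 i)).
by congr (sat phi _); apply: funext => -[x|i] //=; case: unlift.
Qed.

Section TranslationSemantics.
Variables (LA LB : language) (G : code LA LB) (B : structure LB).
Variable p : 'I_(cpar G) -> B.
Local Notation d := (cdim G).

Definition tuple_val (V : Type) (u : V -> 'I_d -> B) :
    V * 'I_d + 'I_(cpar G) -> B :=
  vcat (fun xj => u xj.1 xj.2) p.

Definition atom_holds (V : Type) (a : atom LA V) (u : V -> 'I_d -> B) : Prop :=
  match a with
  | AEq x x' => sim p (u x) (u x')
  | ACst x c => cst_def p c (u x)
  | AFun f xs x0 => fct_def p (u x0) (fun i => u (xs i))
  | ARel R xs => prd_def p (fun i => u (xs i))
  end.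

Lemma sat_in_dom (V : Type) (x : V) (u : V -> 'I_d -> B) :
  sat (in_dom G x) (tuple_val u) <-> dom p (u x).
Proof.
rewrite /in_dom sat_fren /dom /=.
by rewrite (_ : (fun y => _) = vcat (u x) p) //; apply: funext => -[].
Qed.

Lemma sat_tr_atom (V : Type) (a : atom LA V) (u : V -> 'I_d -> B) :
  sat (tr_atom G a) (tuple_val u) <-> atom_holds a u.
Proof.
case: a => [x x'|x c|f xs x0|R xs] /=; rewrite sat_fren.
- rewrite /sim (_ : (fun y => _) = vcat (vcat (u x) (u x')) p) //.
  by apply: funext => -[[]|].
- rewrite /cst_def (_ : (fun y => _) = vcat (u x) p) //.
  by apply: funext => -[].
- rewrite /fct_def.
  rewrite (_ : (fun y => _) =
    vcat (vcat (u x0) (fun ij => u (xs ij.1) ij.2)) p) //.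
  by apply: funext => -[[]|].
- rewrite /prd_def (_ : (fun y => _) = vcat (fun ij => u (xs ij.1) ij.2) p) //.
  by apply: funext => -[].
Qed.

Lemma tuple_val_expose (V : Type) (u : V -> 'I_d -> B) (b : 'I_d -> B) :
  (fun x => vcat (tuple_val u) b (expose x)) = tuple_val (oapp u b).
Proof. by apply: funext => -[[[x|] j]|k]. Qed.

Lemma sat_expose (V : Type) (phi : formula LB (option V * 'I_d + 'I_(cpar G)))
    (u : V -> 'I_d -> B) (b : 'I_d -> B) :
  sat (fren (@expose _ _ G V) phi) (vcat (tuple_val u) b) <->
  sat phi (tuple_val (oapp u b)).
Proof. by rewrite sat_fren tuple_val_expose. Qed.

Lemma sat_tr_ex (V : Type) (nu : nform LA (option V)) (u : V -> 'I_d -> B) :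
  sat (tr_nform G (NEx nu)) (tuple_val u) <->
  exists2 b, dom p b & sat (tr_nform G nu) (tuple_val (oapp u b)).
Proof.
rewrite /= sat_exs; split=> [[b]|[b Ub nub]]; last exists b.
  by rewrite /= !sat_expose sat_in_dom => -[]; exists b.
by rewrite /= !sat_expose sat_in_dom.
Qed.

Lemma sat_tr_all (V : Type) (nu : nform LA (option V)) (u : V -> 'I_d -> B) :
  sat (tr_nform G (NAll nu)) (tuple_val u) <->
  forall b, dom p b -> sat (tr_nform G nu) (tuple_val (oapp u b)).
Proof.
rewrite /= sat_alls; split=> H b.
  by move: (H b); rewrite /= !sat_expose sat_in_dom.
by rewrite /= !sat_expose sat_in_dom; exact: H.
Qed.

Lemma sat_translate (V : finType) (nu : nform LA V) (u : V -> 'I_d -> B) :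
  sat (translate G nu) (tuple_val u) <->
  (forall x, dom p (u x)) /\ sat (tr_nform G nu) (tuple_val u).
Proof.
rewrite /translate.
suff: sat (foldr (fun x chi => And (in_dom G x) chi) (tr_nform G nu) (enum V))
        (tuple_val u) <->
      (forall x, x \in enum V -> dom p (u x)) /\
      sat (tr_nform G nu) (tuple_val u).
  move=> ->; split=> -[H ?]; split=> // x.
  by apply: H; rewrite mem_enum.
elim: (enum V) => [|y l IH]; first by split=> [|[]].
rewrite [foldr _ _ _]/= [sat (And _ _) _]/= IH sat_in_dom.
split=> [[Uy [Ul ?]]|[Ul ?]].
  by split=> // x; rewrite inE => /orP[/eqP->|/Ul].
split; first by apply: Ul; rewrite mem_head.
by split=> // x xl; apply: Ul; rewrite inE xl orbT.
Qed.

Section ExtendedCode.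
Variables (A : structure LA) (gamma : A -> 'I_d -> B).

Lemma psat_plug (V W : Type) (w : V -> 'I_d -> W) (s : nat) (a : 'I_s -> A)
    (chi : formula LB ((V + 'I_s) * 'I_d + 'I_(cpar G))) (t : W -> B) :
  psat (fname (plug p gamma w a) chi) t <->
  sat chi (tuple_val (vcat (fun x j => t (w x j)) (fun i => gamma (a i)))).
Proof.
rewrite psat_fname.
suff -> : (fun x => vcat t id (plug p gamma w a x)) =
    tuple_val (vcat (fun x j => t (w x j)) (fun i => gamma (a i))) by [].
by apply: funext => -[[[]]|].
Qed.

Lemma translates_exists (V : finType) (W : Type) (w : V -> 'I_d -> W)
    (psi : pform A V) :
  exists chi, translates p gamma w psi chi.
Proof.
have [s [psi0 [a [a_inj a_occ psiE]]]] := extract_parameters psi.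
have [nu nuE] := normal_form_exists psi0.
by exists (fname (plug p gamma w a) (translate G nu)), s, psi0, a, nu.
Qed.

(** That the names used by a translation occur in the formula is what bounds the
    parameters of the translation. *)
Lemma translates_parameters (V : finType) (W : Type) (w : V -> 'I_d -> W)
    (psi : pform A V) chi b :
  translates p gamma w psi chi -> foccurs b chi ->
  (exists2 a, foccurs a psi & exists j, b = gamma a j) \/ exists k, b = p k.
Proof.
case=> s [psi0 [a [nu [[_ a_occ] _ _ ->]]]] b_occ.
have [[[[y|i] j]|k] //=] := foccurs_fname b_occ.
  by case=> <-; left; exists (a i) => //; exists j.
by case=> <-; right; exists k.
Qed.

(** A coordinate map, made total by giving it arbitrary values outside of its
    domain, together with a section of it. All conditions are about tuples, so
    that the quotient by sim does not appear. *)
Record coordinates (h : ('I_d -> B) -> A) : Prop := Coordinates {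
  co_dom : forall a, dom p (gamma a);
  co_section : forall a, h (gamma a) = a;
  co_sim : forall b b', dom p b -> dom p b' -> sim p b b' <-> h b = h b';
  co_cst : forall c b, dom p b -> cst_def p c b <-> h b = icst A c;
  co_fct : forall (f : fct LA) b0 (b : 'I_(fct_ar f) -> 'I_d -> B),
    dom p b0 -> (forall i, dom p (b i)) ->
    fct_def p b0 b <-> ifct (fun i => h (b i)) = h b0;
  co_prd : forall (R : prd LA) (b : 'I_(prd_ar R) -> 'I_d -> B),
    (forall i, dom p (b i)) ->
    prd_def p b <-> iprd (fun i => h (b i)) }.

Variable h : ('I_d -> B) -> A.
Hypothesis hP : coordinates h.

Lemma sat_tr_nform (V : Type) (nu : nform LA V) :
  forall u : V -> 'I_d -> B, (forall x, dom p (u x)) ->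
  sat (tr_nform G nu) (tuple_val u) <-> sat (nform_form nu) (fun x => h (u x)).
Proof.
have oE (V' : Type) (u : V' -> 'I_d -> B) b :
    (fun x => h (oapp u b x)) = oapp (fun x => h (u x)) (h b).
  by apply: funext; case.
have oU (V' : Type) (u : V' -> 'I_d -> B) b :
    (forall x, dom p (u x)) -> dom p b -> forall x, dom p (oapp u b x).
  by move=> Uu Ub; case.
elim: nu => {V} [V m|V nu IH|V nu IH] u Uu.
- have atomE (a : atom LA V) : sat (tr_atom G a) (tuple_val u) <->
      sat (atom_form a) (fun x => h (u x)).
    rewrite sat_tr_atom; case: a => [x x'|x c|f xs x0|R xs] /=.
    + exact: co_sim.
    + exact: co_cst.
    + exact: co_fct.
    + exact: co_prd.
  have litE (l : literal LA V) :
      sat (literal_form (@tr_atom _ _ G V) l) (tuple_val u) <->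
      sat (literal_form (@atom_form LA V) l) (fun x => h (u x)).
    by case: l => a /=; rewrite atomE.
  have conjE (c : conjunction LA V) :
      sat (conj_form (@tr_atom _ _ G V) c) (tuple_val u) <->
      sat (conj_form (@atom_form LA V) c) (fun x => h (u x)).
    by elim: c => [l|l c IH] /=; rewrite litE // IH.
  by elim: m => [c|c m IH] /=; rewrite conjE // -IH.
- rewrite sat_tr_ex /=; split=> [[b Ub]|[a nua]].
    by rewrite IH; [exists (h b); rewrite -oE|exact: oU].
  have Ua := co_dom hP a; exists (gamma a) => //.
  by rewrite IH; [rewrite oE (co_section hP)|exact: oU].
- rewrite sat_tr_all /=; split=> [H a|H b Ub].
    have Ua := co_dom hP a; have := H _ Ua.
    by rewrite IH; [rewrite oE (co_section hP)|exact: oU].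
  by rewrite IH; [rewrite oE|exact: oU].
Qed.

(** The right-hand side does not mention the normal form, so all translations of
    a formula are equivalent. The relativization of the parameters to the domain
    is absorbed because gamma takes its values there. *)
Lemma psat_translates (V : finType) (W : Type) (w : V -> 'I_d -> W)
    (psi : pform A V) chi (t : W -> B) :
  translates p gamma w psi chi ->
  psat chi t <-> (forall x, dom p (fun j => t (w x j))) /\
                 psat psi (fun x => h (fun j => t (w x j))).
Proof.
case=> s [psi0 [a [nu [_ -> nuE ->]]]].
rewrite psat_plug sat_translate psat_fname nuE.
have hE : (fun x => h (vcat (fun x j => t (w x j)) (fun i => gamma (a i)) x)) =
    fun x => vcat (fun x => h (fun j => t (w x j))) id
               (vcat inl (fun i => inr (a i)) x).
  by apply: funext => -[x|i] //=; rewrite (co_section hP).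
split=> -[Ut].
  rewrite sat_tr_nform // hE => psih; split=> // x; exact: (Ut (inl x)).
have Uv x : dom p (vcat (fun x j => t (w x j)) (fun i => gamma (a i)) x).
  by case: x => [x|i] /=; [exact: Ut|exact: (co_dom hP)].
by rewrite sat_tr_nform // hE.
Qed.

End ExtendedCode.

End TranslationSemantics.

(** * Interpretations and their coordinate maps *)

Section Interpretations.
Variables (LA LB : language) (G : code LA LB).
Variables (A : structure LA) (B : structure LB) (p : 'I_(cpar G) -> B).
Local Notation d := (cdim G).

Lemma interpretation_coordinates (mu : {b | dom p b} -> A) :
  is_interpretation mu ->
  exists (gamma : A -> 'I_d -> B) (gamma_dom : forall a, dom p (gamma a)) h,
    (forall a, mu (exist _ (gamma a) (gamma_dom a)) = a) /\
    coordinates p gamma h.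
Proof.
case=> mu_surj [wd [mubar [mubarE [mubar_bij mubar_c mubar_f mubar_r]]]].
have mubar_inj := bij_inj mubar_bij.
have [gam gamE] := choice mu_surj.
case: (carrier_inh A) => a0.
pose h b := if pselect (dom p b) is left Ub then mu (exist _ b Ub) else a0.
have hE b (Ub : dom p b) : h b = mubar (cls (sim p) Ub).
  rewrite mubarE /h; case: pselect => // Ub'.
  by congr mu; exact: eq_exist.
have simE b b' (Ub : dom p b) (Ub' : dom p b') :=
  clsP (wd_sim wd) Ub Ub'.
exists (fun a => sval (gam a)), (fun a => proj2_sig (gam a)), h.
have sectE a : mu (exist _ (sval (gam a)) (proj2_sig (gam a))) = a.
  by rewrite -[RHS]gamE; case: (gam a).
split=> //; split.
- by move=> a; exact: (proj2_sig (gam a)).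
- by move=> a; rewrite (hE _ (proj2_sig (gam a))) mubarE sectE.
- move=> b b' Ub Ub'; rewrite -(simE _ _ Ub Ub') (hE _ Ub) (hE _ Ub').
  by split=> [->|/mubar_inj].
- move=> c b Ub; rewrite (hE _ Ub) -mubar_c /=; case: cid => q /= qE.
  by rewrite (qE _ Ub); split=> [->|/mubar_inj].
- move=> f b0 b Ub0 Ub; rewrite (hE _ Ub0).
  under eq_fun => i do rewrite (hE _ (Ub i)).
  rewrite -mubar_f /=; case: cid => g /= gE.
  by rewrite (gE _ Ub0 _ Ub); split=> [->|/mubar_inj].
- move=> R b Ub; under eq_fun => i do rewrite (hE _ (Ub i)).
  by rewrite -mubar_r /=; case: cid => r /= rE; exact: rE.
Qed.

Variables (gamma : A -> 'I_d -> B) (h : ('I_d -> B) -> A).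
Hypothesis hP : coordinates p gamma h.

(** The operations and relations of the quotient are transported from A through
    gamma. *)
Lemma coordinates_interpretation :
  is_interpretation (fun b : {b | dom p b} => h (sval b)).
Proof.
have Ug := co_dom hP.
have simP : equivalence_on (dom p) (sim p).
  split=> [a Ua|a b Ua Ub|a b c Ua Ub Uc]; rewrite !(co_sim hP) //.
  by move=> -> ->.
have repr (q : quot (dom p) (sim p)) :
    exists b, dom p b /\ forall Ub : dom p b, q = cls (sim p) Ub.
  have [b [Ub ->]] := clsE q; exists b; split=> // Ub'.
  by rewrite (Prop_irrelevance Ub Ub').
have [rep repP] := choice repr.
pose hq q := h (rep q).
have hqE b (Ub : dom p b) : hq (cls (sim p) Ub) = h b.
  have [Ur rE] := repP (cls (sim p) Ub).
  by apply/esym/(co_sim hP) => //; apply/(clsP simP Ub Ur).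
have hq_inj : injective hq.
  move=> q q'; have [Ur ->] := repP q; have [Ur' ->] := repP q'.
  by rewrite !hqE => rr'; apply/(clsP simP)/(co_sim hP).
have gE b (Ub : dom p b) : cls (sim p) (Ug (h b)) = cls (sim p) Ub.
  by apply: hq_inj; rewrite !hqE (co_section hP).
split=> [a|].
  by exists (exist _ (gamma a) (Ug a)); exact: co_section hP a.
have wd : well_defined p.
  split=> //.
  - by case: (carrier_inh A) => a; exists (gamma a).
  - move=> c; exists (cls (sim p) (Ug (icst A c))) => b Ub.
    by rewrite (co_cst hP) // (clsP simP) (co_sim hP) // (co_section hP).
  - move=> f; exists (fun q => cls (sim p) (Ug (ifct (fun i => hq (q i))))).
    move=> b0 Ub0 b Ub; rewrite (co_fct hP) // (clsP simP) (co_sim hP) //.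
    rewrite (co_section hP); under [in X in _ <-> X]eq_fun => i do rewrite hqE.
    by split=> ->.
  - move=> R; exists (fun q => iprd (fun i => hq (q i))) => b Ub.
    rewrite (co_prd hP) //.
    by under [in X in _ <-> X]eq_fun => i do rewrite hqE.
exists wd, hq; split=> [b Ub|]; first exact: hqE.
split=> /=.
- exists (fun a => cls (sim p) (Ug a)) => [q|a].
    by apply: hq_inj; rewrite hqE (co_section hP).
  by rewrite hqE (co_section hP).
- move=> c; case: cid => q /= qE; have [Ur rE] := repP q.
  by apply/(co_cst hP) => //; apply/(qE _ Ur).
- move=> f q; case: cid => g /= gE'.
  have [Ur rE] := repP (g q).
  apply/esym/(co_fct hP) => // [i|]; first by case: (repP (q i)).
  apply/(gE' _ Ur) => [i|Ub]; first by case: (repP (q i)).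
  rewrite -rE; congr g; apply: funext => i.
  by have [_] := repP (q i); apply.
- move=> R q; case: cid => r /= rE.
  have Ur i : dom p (rep (q i)) by case: (repP (q i)).
  rewrite /hq -(co_prd hP) // (rE _ Ur).
  rewrite (_ : (fun i => _) = q) //; apply: funext => i.
  by have [_] := repP (q i); move=> <-.
Qed.

End Interpretations.

(** * Tuples of tuples *)

Section Packing.
Variables (T : Type) (m d : nat).

Definition unpack (t : 'I_(m * d) -> T) (i : 'I_m) (j : 'I_d) : T :=
  t (mxvec_index i j).

Definition pack (u : 'I_m -> 'I_d -> T) (k : 'I_(m * d)) : T :=
  let ij := enum_val (cast_ord (esym (mxvec_cast m d)) k) in u ij.1 ij.2.

Lemma packK : cancel pack unpack.
Proof.
move=> u; apply: funext => i; apply: funext => j.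
by rewrite /unpack /pack /mxvec_index cast_ordK enum_rankK.
Qed.

End Packing.

(** * Coordinate maps from the preservation of emptiness *)

Section Emptiness.
Variables (LA LB : language) (G : code LA LB).
Variables (A : structure LA) (B : structure LB) (p : 'I_(cpar G) -> B).
Variable gamma : A -> 'I_(cdim G) -> B.
Local Notation d := (cdim G).

(** Arguments about unsolvable systems are carried out with such pairs (Q, Q'), so
    that the syntax of translations only enters in the proofs that a pair
    transfers. *)
Definition transfers (m : nat) (Q : ('I_m -> A) -> Prop)
    (Q' : ('I_m -> 'I_d -> B) -> Prop) : Prop :=
  exists psi chi, [/\ translates1 p gamma psi chi,
    forall v, psat psi v <-> Q v
  & forall t, psat chi t <->
      (forall x, dom p (unpack t x)) /\ Q' (unpack t)].

Lemma transfers_nform (m s : nat) (a : 'I_s -> A)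
    (nu : nform LA ('I_m + 'I_s)) :
  injective a -> (forall i, dom p (gamma (a i))) ->
  (forall i, foccurs (a i)
     (fname (vcat (@inl 'I_m A) (fun i => inr (a i))) (nform_form nu))) ->
  transfers (fun v => sat (nform_form nu) (vcat v a))
    (fun u =>
       sat (tr_nform G nu) (tuple_val p (vcat u (fun i => gamma (a i))))).
Proof.
move=> a_inj Ua a_occ.
exists (fname (vcat inl (fun i => inr (a i))) (nform_form nu)).
exists (fname (plug p gamma (fun i j => mxvec_index i j) a) (translate G nu)).
split.
- by exists s, (nform_form nu), a, nu.
- move=> v; rewrite psat_fname.
  by rewrite (_ : (fun x => _) = vcat v a) //; apply: funext => -[].
- move=> t; rewrite psat_plug sat_translate; split=> -[Ut ?]; split=> // x.
    exact: (Ut (inl x)).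
  by case: x => [x|i]; [exact: Ut|exact: Ua].
Qed.

Lemma transfers_literal (m : nat) (l : literal LA ('I_m + 'I_0)) :
  transfers
    (fun v => sat (literal_form (@atom_form _ _) l) (vcat v (no_ord A)))
    (fun u => sat (literal_form (@tr_atom _ _ G _) l)
                (tuple_val p (vcat u (fun i => gamma (no_ord A i))))).
Proof.
by apply: (@transfers_nform _ _ (no_ord A) (NMat (DnfOne (ConjOne l)))) => -[].
Qed.

Lemma transfers_notnot (m : nat) (Q : ('I_m -> A) -> Prop) Q' :
  transfers Q Q' -> transfers (fun v => ~ ~ Q v) (fun u => ~ ~ Q' u).
Proof.
case=> psi [chi [tr psiE chiE]]; exists psi, chi.
by split=> // [v|t]; rewrite ?psiE ?chiE notK.
Qed.

Hypothesis F1 : forall m (S : set (pform A 'I_m)) T,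
  admissible Infty Infty S -> trans_set p gamma S T ->
  (logset S = set0 <-> logset T = set0).

(** The premises, of which there may be infinitely many, and the negation of the
    conclusion form an unsolvable system, hence so do their translations. *)
Lemma transfer_implication (m : nat) (K : Type)
    (Q : K -> ('I_m -> A) -> Prop) Q' (Q0 : ('I_m -> A) -> Prop) Q0' :
  (forall k, transfers (Q k) (Q' k)) ->
  transfers (fun v => ~ Q0 v) (fun u => ~ Q0' u) ->
  (forall v, (forall k, Q k v) -> Q0 v) ->
  forall u, (forall x, dom p (u x)) -> (forall k, Q' k u) -> Q0' u.
Proof.
move=> tr tr0 imp u Uu Q'u; apply: contrapT => nQ0'u.
have tr_opt (k : option K) : exists psichi : pform A 'I_m * pform B 'I_(m * d),
    [/\ translates1 p gamma psichi.1 psichi.2,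
      forall v, psat psichi.1 v <-> oapp Q (fun v => ~ Q0 v) k v
    & forall t, psat psichi.2 t <->
        (forall x, dom p (unpack t x)) /\
        oapp Q' (fun u => ~ Q0' u) k (unpack t)].
  by case: k => [k|]; [have [psi [chi H]] := tr k|have [psi [chi H]] := tr0];
    exists (psi, chi).
have [sys sysP] := choice tr_opt.
(* several indices may share a formula of S: tau picks one of the translations *)
pose S := [set psi | exists k, psi = (sys k).1].
have /choice[tau tauP] : forall psi, exists chi, S psi ->
    exists2 k, psi = (sys k).1 & chi = (sys k).2.
  move=> psi; have [[k ->]|nS] := pselect (S psi); last by exists (sys None).2.
  by exists (sys k).2; exists k.
have trS : trans_set p gamma S (tau @` S).
  by exists tau => // psi /tauP[k -> ->]; have [] := sysP k.
have S0 : logset S = set0.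
  apply/seteqP; split=> // v Sv.
  have QS k : oapp Q (fun v => ~ Q0 v) k v.
    by have [_ + _] := sysP k; move=> <-; apply: Sv; exists k.
  by apply: (QS None); apply: imp => k; exact: (QS (Some k)).
have adm : admissible Infty Infty S by split=> //; exists (sys None).1, None.
have T0 := (F1 adm trS).1 S0.
suff: logset (tau @` S) (pack u) by rewrite T0.
move=> _ [psi /tauP[k _ ->] <-]; have [_ _ ->] := sysP k; rewrite packK.
by split=> //; case: k.
Qed.

(** The equation x = a is solvable, so its translation is; every solution of the
    latter has gamma a in the domain, because a translation relativizes all its
    variables, including those that are replaced by parameters. *)
Lemma parameters_in_dom (a : A) : dom p (gamma a).
Proof.
pose nu : nform LA ('I_1 + 'I_1) :=
  NMat (DnfOne (ConjOne (Pos (AEq LA (inl ord0) (inr ord0))))).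
pose w (i : 'I_1) (j : 'I_d) := mxvec_index i j.
pose psi : pform A 'I_1 := fname (vcat inl (fun i => inr a)) (nform_form nu).
pose chi := fname (plug p gamma w (fun i : 'I_1 => a)) (translate G nu).
have tr : translates1 p gamma psi chi.
  exists 1%N, (nform_form nu), (fun=> a), nu; split=> //; split=> [i j _|i] /=.
    by rewrite !ord1.
  by right.
have trS : trans_set p gamma [set psi] ((fun=> chi) @` [set psi]).
  by exists (fun=> chi) => // _ ->.
have adm : admissible Infty Infty [set psi] by split=> //; exists psi.
have [t Tt] : logset ((fun=> chi) @` [set psi]) !=set0.
  apply: contrapT => /set0P/negP/negPn/eqP /(F1 adm trS).2 S0.
  suff: logset [set psi] (fun=> a) by rewrite S0.
  by move=> _ ->.
have: psat chi t by apply: Tt; exists psi.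
by rewrite psat_plug sat_translate => -[/(_ (inr ord0))].
Qed.

Lemma transfers_eq_parameter (m : nat) (x : 'I_m) (a : A) :
  transfers (fun v => v x = a) (fun u => sim p (u x) (gamma a)) /\
  transfers (fun v => ~ v x = a) (fun u => ~ sim p (u x) (gamma a)).
Proof.
pose eqa : atom LA ('I_m + 'I_1) := AEq LA (inl x) (inr ord0).
have a_inj : injective (fun _ : 'I_1 => a) by move=> i j _; rewrite !ord1.
have Ua (i : 'I_1) := parameters_in_dom a.
split.
  have [|psi [chi [tr psiE chiE]]] :=
    transfers_nform (nu := NMat (DnfOne (ConjOne (Pos eqa)))) a_inj Ua.
    by move=> i; right.
  by exists psi, chi; split=> // t; rewrite chiE (sat_tr_atom p eqa).
have [|psi [chi [tr psiE chiE]]] :=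
  transfers_nform (nu := NMat (DnfOne (ConjOne (Opp eqa)))) a_inj Ua.
  by move=> i; right.
by exists psi, chi; split=> // t; rewrite chiE /= (sat_tr_atom p eqa).
Qed.

(** The system of all inequations x <> a, with a in A, is unsolvable in A, hence so
    is its translation. The system has one formula for every element of A. *)
Lemma near_parameter b : dom p b -> exists a, sim p b (gamma a).
Proof.
move=> Ub; apply: contrapT => /forallNP nb.
have [a0] := carrier_inh A.
(* the inequation for a0 serves as the negated conclusion *)
apply: (nb a0).
apply: (@transfer_implication 1 A (fun a v => ~ v ord0 = a)
  (fun a u => ~ sim p (u ord0) (gamma a)) (fun v => v ord0 = a0)
  (fun u => sim p (u ord0) (gamma a0)) _ _ _ (fun=> b)) => //.
- by move=> a; exact: (transfers_eq_parameter ord0 a).2.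
- exact: (transfers_eq_parameter ord0 a0).2.
- by move=> v /(_ (v ord0)).
Qed.

(** The premises x = h (u x) pin down the point of A at which the atom is
    evaluated, so that the implication from them to the atom holds everywhere in A
    as soon as the atom holds at this one point. *)
Lemma atom_transfer (m : nat) (h : ('I_d -> B) -> A) (a : atom LA ('I_m + 'I_0))
    (u : 'I_m -> 'I_d -> B) :
  (forall x, dom p (u x)) -> (forall x, sim p (u x) (gamma (h (u x)))) ->
  sat (tr_atom G a) (tuple_val p (vcat u (fun i => gamma (no_ord A i)))) <->
  sat (atom_form a) (vcat (fun x => h (u x)) (no_ord A)).
Proof.
move=> Uu hu.
have pinned (v : 'I_m -> A) : (forall x, v x = h (u x)) -> v = fun x => h (u x).
  by move=> vE; apply: funext.
split=> [tra|sata]; last first.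
  apply: (transfer_implication (fun x => (transfers_eq_parameter x (h (u x))).1)
    (transfers_literal (Opp a)) _ Uu hu).
  by move=> v /pinned ->.
apply: contrapT => nsata; move: tra.
change (~ sat (tr_atom G a)
            (tuple_val p (vcat u (fun i => gamma (no_ord A i))))).
apply: (transfer_implication (fun x => (transfers_eq_parameter x (h (u x))).1)
  (transfers_notnot (transfers_literal (Pos a))) _ Uu hu).
by move=> v /pinned ->.
Qed.

Lemma coordinates_of_emptiness : exists h, coordinates p gamma h.
Proof.
have [a0] := carrier_inh A.
have /choice[h hP] : forall b, exists a, dom p b -> sim p b (gamma a).
  move=> b; have [Ub|nUb] := pselect (dom p b); last by exists a0.
  by have [a ba] := near_parameter Ub; exists a.
have Ug := parameters_in_dom.
pose pair (T : Type) (x y : T) (i : 'I_2) := if i == ord0 then x else y.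
have simE b b' : dom p b -> dom p b' -> sim p b b' <-> h b = h b'.
  move=> Ub Ub'.
  have /= := @atom_transfer 2 h (AEq LA (inl ord0) (inl ord_max)) (pair _ b b').
  rewrite (sat_tr_atom p (AEq LA (inl ord0) (inl ord_max))) /=; apply.
    by case=> -[|[]].
  by case=> -[|[]] //= ?; exact: hP.
exists h; split=> //.
- move=> a; apply: contrapT => hga.
  (* x = h (gamma a) would imply x <> a, which fails at x = gamma a *)
  have := transfer_implication (m := 1)
    (fun _ : unit => (transfers_eq_parameter ord0 (h (gamma a))).1)
    (transfers_notnot (transfers_eq_parameter ord0 a).1) _
    (fun _ => Ug a) (fun _ => hP _ (Ug a)).
  apply; last exact/simE.
  by move=> v /(_ tt) ->.
- move=> c b Ub.
  have /= := @atom_transfer 1 h (ACst (inl ord0) c) (fun=> b).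
  by rewrite (sat_tr_atom p (ACst (inl ord0) c)) /=; apply=> // _; exact: hP.
- move=> f b0 b Ub0 Ub.
  pose at_f := @AFun LA ('I_(fct_ar f).+1 + 'I_0) f
    (fun i => inl (lift ord0 i)) (inl ord0).
  have /= := @atom_transfer _ h at_f (fun x => oapp b b0 (unlift ord0 x)).
  rewrite (sat_tr_atom p at_f) /= unlift_none /=.
  rewrite (_ : (fun i => _) = b); last by apply: funext => i; rewrite liftK.
  rewrite (_ : (fun i => _) = fun i => h (b i)); last first.
    by apply: funext => i; rewrite liftK.
  by apply=> x; case: (unlift ord0 x) => [i|] //=; exact: hP.
- move=> R b Ub.
  pose at_R := @ARel LA ('I_(prd_ar R) + 'I_0) R inl.
  have /= := @atom_transfer _ h at_R b.
  by rewrite (sat_tr_atom p at_R) /=; apply=> // x; exact: hP.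
Qed.

End Emptiness.

(** * The functor *)

Section ProjectiveSets.
Variables (L : language) (A : structure L).

Lemma pl_equivalence (m : nat) (X : plset A m) :
  equivalence_on (pl_set X) (@pl_rel _ _ _ X).
Proof. by have [E [[]]] := pl_eqv X. Qed.

Lemma pl_clsP (m : nat) (X : plset A m) a b
    (Xa : pl_set X a) (Xb : pl_set X b) :
  pl_cls Xa = pl_cls Xb <-> @pl_rel _ _ _ X a b.
Proof. exact: clsP (pl_equivalence X) _ _ _ _. Qed.

Lemma plset_eq (m : nat) (X Y : plset A m) :
  pl_set X = pl_set Y -> @pl_rel _ _ _ X = @pl_rel _ _ _ Y -> X = Y.
Proof.
case: X => X RX Xn Xl Xe; case: Y => Y RY Yn Yl Ye /= XY RXY.
subst Y RY; by congr PLSet; exact: Prop_irrelevance.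
Qed.

Lemma PQuot_inj (m : nat) (X Y : plset A m) : PQuot X = PQuot Y -> X = Y.
Proof.
move=> XY.
pose get O : plset A m := match O with
  | PEmpty => X
  | PQuot k Z =>
      if k =P m is ReflectT e then eq_rect k (fun k => plset A k) Z m e else X
  end.
have := congr1 get XY; rewrite /get; case: eqP => // e.
by rewrite (eq_irrelevance e erefl).
Qed.

Lemma induces_eqv_uniq (m : nat) (X : set ('I_m -> A)) R R' E :
  induces_eqv X R E -> induces_eqv X R' E -> R = R'.
Proof.
case=> [[_ RX] RE _] [[_ R'X] R'E _].
apply: funext => a; apply: funext => b; apply/propext; split=> Rab.
  by have [Xa Xb] := RX _ _ Rab; apply/R'E => //; apply/RE.
by have [Xa Xb] := R'X _ _ Rab; apply/RE => //; apply/R'E.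
Qed.

Lemma induces_map_uniq (m s : nat) (X : plset A m) (Y : plset A s) phi
    (f g : pl_quot X -> pl_quot Y) :
  induces_map phi f -> induces_map phi g -> f = g.
Proof.
move=> [f1 _] [g1 _]; apply: funext => q; have [a [Xa ->]] := clsE q.
have [b [Yb fb]] := clsE (f (pl_cls Xa)).
by rewrite fb; apply/esym/g1/f1.
Qed.

(** The translation of the empty system is empty and defines all tuples of B,
    not only those in the domain. Adjoining a tautology makes a system
    non-empty without adding parameters; thanks to its bound variable this one
    exists even when there are neither free variables nor constants. *)
Definition tautology (V : Type) : pform A V := Ex (Eq (Var None) (Var None)).

Lemma logset_setU1_true (m : nat) (S : set (pform A 'I_m)) :
  logset (S `|` [set tautology _]) = logset S.
Proof.
apply/seteqP; split=> v Sv psi; first by move=> Spsi; apply: Sv; left.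
case=> [/Sv//|->]; case: (carrier_inh A) => a; by exists a.
Qed.

End ProjectiveSets.

Section Functor.
Variables (LA LB : language) (G : code LA LB).
Variables (A : structure LA) (B : structure LB) (p : 'I_(cpar G) -> B).
Variables (gamma : A -> 'I_(cdim G) -> B) (h : ('I_(cdim G) -> B) -> A).
Hypothesis hP : coordinates p gamma h.
Local Notation d := (cdim G).

Definition all_dom (m : nat) (t : 'I_(m * d) -> B) : Prop :=
  forall x, dom p (unpack t x).

Definition coord (m : nat) (t : 'I_(m * d) -> B) (x : 'I_m) : A :=
  h (unpack t x).

Definition lift_tuple (m : nat) (a : 'I_m -> A) : 'I_(m * d) -> B :=
  pack (fun x => gamma (a x)).

Lemma all_dom_lift (m : nat) (a : 'I_m -> A) : all_dom (lift_tuple a).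
Proof. by move=> x; rewrite /lift_tuple packK; exact: (co_dom hP). Qed.

Lemma coord_lift (m : nat) (a : 'I_m -> A) : coord (lift_tuple a) = a.
Proof. by apply: funext => x; rewrite /coord packK (co_section hP). Qed.

Definition pull (m : nat) (X : set ('I_m -> A)) : set ('I_(m * d) -> B) :=
  [set t | all_dom t /\ X (coord t)].

Definition pull_rel (m : nat) (R : ('I_m -> A) -> ('I_m -> A) -> Prop)
    (t t' : 'I_(m * d) -> B) : Prop :=
  [/\ all_dom t, all_dom t' & R (coord t) (coord t')].

Lemma pull_lift (m : nat) (X : set ('I_m -> A)) a :
  pull X (lift_tuple a) <-> X a.
Proof.
by rewrite /pull /= coord_lift; split=> [[]|Xa] //; split=> //; exact: all_dom_lift.
Qed.

Lemma pull_inj (m : nat) : injective (@pull m).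
Proof.
move=> X Y XY; apply/seteqP; split=> a /pull_lift.
  by rewrite XY => /pull_lift.
by rewrite -XY => /pull_lift.
Qed.

Lemma pull_rel_inj (m : nat) : injective (@pull_rel m).
Proof.
move=> R R' RR'; apply: funext => a; apply: funext => b; apply/propext.
have := congr1 (fun Q => Q (lift_tuple a) (lift_tuple b)) RR'.
rewrite /pull_rel !coord_lift => E; have Ua := all_dom_lift a.
have Ub := all_dom_lift b; split=> Rab.
  have: [/\ all_dom (lift_tuple a), all_dom (lift_tuple b) & R a b] by [].
  by rewrite E => -[].
have: [/\ all_dom (lift_tuple a), all_dom (lift_tuple b) & R' a b] by [].
by rewrite -E => -[].
Qed.

Lemma logset_trans_set (m : nat) (S : set (pform A 'I_m)) T :
  S !=set0 -> trans_set p gamma S T -> logset T = pull (logset S).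
Proof.
move=> [psi0 Spsi0] [tau tauP ->]; apply/seteqP; split=> t.
  move=> Tt; have tS psi : S psi -> all_dom t /\ psat psi (coord t).
    move=> Spsi; apply/(psat_translates hP t (tauP _ Spsi)).
    by apply: Tt; exists psi.
  by split=> [|psi /tS[]//]; case: (tS _ Spsi0).
move=> [Ut St] _ [psi Spsi <-].
by apply/(psat_translates hP t (tauP _ Spsi)); split=> //; exact: St.
Qed.

Lemma psat_trans2 (m s : nat) (phi : pform A ('I_m + 'I_s)) chi t t' :
  trans2 p gamma phi chi ->
  psat chi (vcat t t') <->
  [/\ all_dom t, all_dom t' & psat phi (vcat (coord t) (coord t'))].
Proof.
move=> tr; rewrite (psat_translates hP _ tr).
rewrite (_ : (fun x => _) = vcat (coord t) (coord t')); last first.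
  by apply: funext => -[].
split=> [[U ?]|[Ut Ut' ?]]; split=> //.
- by move=> x; exact: (U (inl x)).
- by move=> x; exact: (U (inr x)).
- by case=> x; [exact: Ut|exact: Ut'].
Qed.

Lemma trans_set_exists (m : nat) (S : set (pform A 'I_m)) :
  exists T, trans_set p gamma S T.
Proof.
have [tau tauP] := choice (translates_exists p gamma (@mxvec_index m d)).
by exists (tau @` S), tau => // psi _; exact: tauP.
Qed.

Lemma trans2_exists (m s : nat) (phi : pform A ('I_m + 'I_s)) :
  exists chi, trans2 p gamma phi chi.
Proof. exact: translates_exists. Qed.

Lemma induces_eqv_pull (m : nat) (X : set ('I_m -> A)) R E Ebar :
  induces_eqv X R E -> trans2 p gamma E Ebar ->
  induces_eqv (pull X) (pull_rel R) Ebar.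
Proof.
move=> [[[Rr Rs Rt] RX] RE EX] tr; split; first split; first split.
- by move=> t [Ut Xt]; split=> //; exact: Rr.
- by move=> t t' [_ Xt] [_ Xt'] [? ? ?]; split=> //; exact: Rs.
- move=> t t' t'' [_ Xt] [_ Xt'] [_ Xt''] [? ? ?] [_ ? ?]; split=> //.
  exact: Rt Xt Xt' Xt'' _ _.
- by move=> t t' [Ut Ut' /RX[]].
- move=> t t' [Ut Xt] [Ut' Xt']; rewrite (psat_trans2 _ _ tr).
  by split=> -[? ? H]; split=> //; apply/RE.
- move=> t t' [Ut Xt]; rewrite !(psat_trans2 _ _ tr) => tt'.
  split; first by case: tt' => -[].
  by apply: EX Xt _; case: tt' => -[_ _]; [left|right].
Qed.

Section Object.
Variables (m : nat) (X : plset A m).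

Lemma pull_nonempty : pull (pl_set X) !=set0.
Proof.
by have [a Xa] := pl_nonempty X; exists (lift_tuple a); apply/pull_lift.
Qed.

Lemma pl_system : exists S, S !=set0 /\ pl_set X = logset S.
Proof.
have [S XS] := pl_logical X.
exists (S `|` [set tautology A _]).
rewrite logset_setU1_true; split=> //.
by exists (tautology A _); right.
Qed.

Lemma pull_logical : exists T, pull (pl_set X) = logset T.
Proof.
have [S [S0 ->]] := pl_system; have [T trS] := trans_set_exists S.
by exists T; rewrite (logset_trans_set S0 trS).
Qed.

Lemma pull_eqv :
  exists E, induces_eqv (pull (pl_set X)) (pull_rel (@pl_rel _ _ _ X)) E.
Proof.
have [E XE] := pl_eqv X; have [Ebar tr] := trans2_exists E.
by exists Ebar; exact: induces_eqv_pull XE tr.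
Qed.

Definition bar : plset B (m * d) := PLSet pull_nonempty pull_logical pull_eqv.

(** The bijection between the two quotients that the coordinate map induces. *)
Definition down (q : pl_quot bar) : pl_quot X :=
  let: exist t Ht := cid (clsE q) in let: exist Tt _ := cid Ht in pl_cls Tt.2.

Definition up (q : pl_quot X) : pl_quot bar :=
  let: exist a Ha := cid (clsE q) in let: exist Xa _ := cid Ha in
  @pl_cls _ _ _ bar (lift_tuple a) ((pull_lift _ _).2 Xa).

Lemma down_cls t (Tt : pl_set bar t) (Xt : pl_set X (coord t)) :
  down (pl_cls Tt) = pl_cls Xt.
Proof.
rewrite /down; case: cid => t' Ht'; case: cid => T't' E.
by have [_ _ ?] := (pl_clsP _ _).1 E; apply/esym/pl_clsP.
Qed.

Lemma up_cls t (Tt : pl_set bar t) (Xt : pl_set X (coord t)) :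
  up (pl_cls Xt) = pl_cls Tt.
Proof.
rewrite /up; case: cid => a Ha; case: cid => Xa /esym/pl_clsP Ea.
apply/pl_clsP; split; [exact: all_dom_lift|by case: Tt|by rewrite coord_lift].
Qed.

Lemma downK : cancel down up.
Proof.
move=> q; have [t [Tt ->]] := clsE q.
by rewrite (down_cls Tt Tt.2) (up_cls Tt).
Qed.

Lemma upK : cancel up down.
Proof.
move=> q; have [a [Xa ->]] := clsE q; have Ta := (pull_lift (pl_set X) a).2 Xa.
have Xa' := Ta.2; rewrite (_ : cls _ Xa = pl_cls Xa').
  by rewrite (up_cls Ta) (down_cls Ta Xa').
by apply/pl_clsP; rewrite coord_lift; case: (pl_equivalence X) => + _ _; exact.
Qed.

End Object.

Section Map.
Variables (m s : nat) (X : plset A m) (Y : plset A s).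

Definition bar_map (f : pl_quot X -> pl_quot Y) :
    pl_quot (bar X) -> pl_quot (bar Y) :=
  @up _ Y \o f \o @down _ X.

Lemma bar_map_inj : injective bar_map.
Proof.
move=> f g fg; apply: funext => q.
have /(can_inj (@upK _ Y)) := congr1 (fun F => F (up q)) fg.
by rewrite /= upK.
Qed.

Lemma induces_bar_map phi phibar (f : pl_quot X -> pl_quot Y) :
  induces_map phi f -> trans2 p gamma phi phibar ->
  induces_map phibar (bar_map f).
Proof.
move=> [f1 f2] tr.
split=> [t t' Tt Tt'|t t' [Ut Xt] nT]; rewrite (psat_trans2 _ _ tr).
  have [[Ut Xt] [Ut' Yt']] := (Tt, Tt').
  rewrite /bar_map /= (down_cls Tt Xt) -(up_cls Tt' Yt').
  split=> [/(can_inj (@upK _ Y))/f1|[_ _ /f1 ->]] //.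
move=> [_ Ut' phitt']; apply: nT; split=> //.
by apply: contrapT => /(f2 _ _ Xt).
Qed.

Lemma bar_formula_map (f : formula_map X Y) :
  exists phi, induces_map phi (bar_map (sval f)).
Proof.
case: f => f [phi fphi]; have [phibar tr] := trans2_exists phi.
by exists phibar; exact: induces_bar_map tr.
Qed.

End Map.

Lemma bar_map_id (m : nat) (X : plset A m) : bar_map (@id (pl_quot X)) = id.
Proof. by apply: funext => q; rewrite /bar_map /= downK. Qed.

Lemma bar_map_comp (m s k : nat) (X : plset A m) (Y : plset A s)
    (Z : plset A k) (f : pl_quot X -> pl_quot Y) (g : pl_quot Y -> pl_quot Z) :
  bar_map (g \o f) = bar_map g \o bar_map f.
Proof. by apply: funext => q; rewrite /bar_map /= upK. Qed.

Definition tr_ob (O : plobj A) : plobj B :=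
  match O with
  | PEmpty => PEmpty B
  | PQuot m X => PQuot (bar X)
  end.

Definition tr_mor (O O' : plobj A) : plhom O O' -> plhom (tr_ob O) (tr_ob O') :=
  match O, O' with
  | PEmpty, _ => fun _ => tt
  | PQuot _ _, PEmpty => fun f => f
  | PQuot _ X, PQuot _ Y =>
      fun f => exist _ (bar_map (sval f)) (bar_formula_map f)
  end.

Lemma tr_mor_id (O : plobj A) : tr_mor (plid O) = plid (tr_ob O).
Proof. by case: O => [|m X] //=; apply: eq_exist; exact: bar_map_id. Qed.

Lemma tr_mor_cmp (O1 O2 O3 : plobj A) (f : plhom O1 O2) (g : plhom O2 O3) :
  tr_mor (plcmp f g) = plcmp (tr_mor f) (tr_mor g).
Proof.
case: O1 O2 O3 f g => [|m X] [|s Y] [|k Z] //= f g; try by case: f.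
by apply: eq_exist; exact: bar_map_comp.
Qed.

Definition tr_functor : functor (PLS A) (PLS B) :=
  @Functor (PLS A) (PLS B) tr_ob tr_mor tr_mor_id tr_mor_cmp.

Lemma bar_inj (m : nat) (X Y : plset A m) : bar X = bar Y -> X = Y.
Proof.
move=> XY; apply: plset_eq; first exact: pull_inj (congr1 (@pl_set _ _ _) XY).
exact: pull_rel_inj (congr1 (@pl_rel _ _ _) XY).
Qed.

Lemma tr_functor_embedding : embedding tr_functor.
Proof.
split=> [[|m X] [|s Y]|[|m X] [|s Y]] //=.
- by move=> [] [].
- by move=> [] [].
- by move=> [f Hf] [g Hg] [/bar_map_inj fg]; exact: eq_exist.
- move=> XY; have ms : m = s.
    have: m * d = s * d by case: XY.
    by move/eqP; rewrite eqn_pmul2r ?cdim_gt0 // => /eqP.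
  by subst s; congr PQuot; exact/bar_inj/PQuot_inj.
Qed.

(** * The existence conditions *)

(** A formula determines the equivalence relation that it induces, so the
    translated objects, whatever systems, formulas and normal forms they come
    from, are the pullbacks. *)
Lemma trans_obj_by_bar (m : nat) (X : plset A m) Xbar S T E Ebar :
  S !=set0 -> trans_obj_by p gamma X Xbar S T E Ebar -> Xbar = bar X.
Proof.
move=> S0 [[XS XE] trS trE [XT XTE]]; have TX := logset_trans_set S0 trS.
have XbarE : pl_set Xbar = pl_set (bar X) by rewrite XT TX /= XS.
apply: plset_eq => //; apply: induces_eqv_uniq XTE _.
by rewrite XbarE; exact: induces_eqv_pull XE trE.
Qed.

Lemma bar_trans_obj_by (m : nat) (X : plset A m) S T E Ebar :
  S !=set0 -> pl_set X = logset S ->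
  induces_eqv (pl_set X) (@pl_rel _ _ _ X) E ->
  trans_set p gamma S T -> trans2 p gamma E Ebar ->
  trans_obj_by p gamma X (bar X) S T E Ebar.
Proof.
move=> S0 XS XE trS trE; split=> //.
rewrite (logset_trans_set S0 trS) -XS.
by split=> //; exact: induces_eqv_pull XE trE.
Qed.

Lemma trans_obj_bar alpha beta (m : nat) (X : plset A m) Xbar :
  trans_obj p gamma alpha beta X Xbar -> Xbar = bar X.
Proof. by case=> S [T [E [Ebar [[S0 _] /(trans_obj_by_bar S0)]]]]. Qed.

Lemma bar_trans_obj (m : nat) (X : plset A m) :
  trans_obj p gamma Infty Infty X (bar X).
Proof.
have [S [S0 XS]] := pl_system X; have [E XE] := pl_eqv X.
have [T trS] := trans_set_exists S; have [Ebar trE] := trans2_exists E.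
by exists S, T, E, Ebar; split=> //; exact: bar_trans_obj_by.
Qed.

Lemma coordinates_conditions alpha beta : functor_conditions p gamma alpha beta.
Proof.
split.
- move=> m S T [S0 _] /(logset_trans_set S0) ->.
  rewrite -(_ : pull set0 = set0); last by apply/seteqP; split=> t // [].
  by split=> [->//|/pull_inj].
- move=> m S S' T T' [S0 _] [S'0 _].
  by move=> /(logset_trans_set S0) -> /(logset_trans_set S'0) -> ->.
- move=> m S T E Ebar [S0 _] /(logset_trans_set S0) -> trE _ [R RE].
  by exists (pull_rel R); exact: induces_eqv_pull trE.
- move=> m S T E E' Ebar E'bar [S0 _] /(logset_trans_set S0) ->.
  move=> trE trE' _ [R [RE RE']]; exists (pull_rel R).
  by split; [exact: induces_eqv_pull trE|exact: induces_eqv_pull trE'].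
- move=> m s X Y Xbar Ybar phi phibar /trans_obj_bar -> /trans_obj_bar -> tr.
  by case=> f fphi; exists (bar_map f); exact: induces_bar_map tr.
- move=> m s X Y Xbar Ybar phi phi' phibar phi'bar.
  move=> /trans_obj_bar -> /trans_obj_bar -> tr tr' [f [fphi fphi']].
  exists (bar_map f).
  by split; [exact: induces_bar_map tr|exact: induces_bar_map tr'].
- move=> m s k X Y Z Xbar Ybar Zbar phi psi phibar psibar chibar f g fbar gbar.
  move=> /trans_obj_bar XE /trans_obj_bar YE /trans_obj_bar ZE.
  subst Xbar Ybar Zbar.
  move=> trf trg trgf fphi gpsi fbarP gbarP.
  rewrite (induces_map_uniq fbarP (induces_bar_map fphi trf)).
  rewrite (induces_map_uniq gbarP (induces_bar_map gpsi trg)).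
  by rewrite -bar_map_comp; apply: induces_bar_map trgf; exact: induces_fcompose.
Qed.

Lemma tr_functor_interpretation : is_interpretation_functor p gamma tr_functor.
Proof.
split=> //.
- exact: coordinates_conditions.
- move=> m X S T E Ebar S0 XS XE trS trE.
  by exists (bar X); first exact: bar_trans_obj_by.
- move=> m s X Y f phi phibar fphi tr; exists (bar X), (bar Y).
  exists (exist _ (bar_map (sval f)) (bar_formula_map f)); split=> //.
  + exact: bar_trans_obj.
  + exact: bar_trans_obj.
  + exact: induces_bar_map tr.
Qed.

(** * Bounded systems *)

Lemma system_bounded_setU1_true alpha beta (m : nat) (S : set (pform A 'I_m)) :
  infinite_bound beta -> system_bounded alpha beta S ->
  system_bounded alpha beta (S `|` [set tautology A _]).
Proof.
move=> beta_inf [Sb Sa]; split.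
  apply: (@smaller_copies _ _ S _ beta 1 1 (fun psi _ => psi)
           (fun=> tautology A _)) => // psi.
  by case=> [Spsi|->]; [left; exists psi => //; exists ord0|right; exists ord0].
congr (smaller _ alpha): Sa; apply/seteqP; split=> a [psi].
  by exists psi => //; left.
by case=> [Spsi|-> []//]; exists psi.
Qed.

Lemma trans_set_bounded alpha beta (m : nat) (S : set (pform A 'I_m)) T :
  infinite_bound alpha -> infinite_bound beta ->
  system_bounded alpha beta S -> trans_set p gamma S T ->
  system_bounded alpha beta T.
Proof.
move=> alpha_inf beta_inf [Sb Sa] [tau tauP ->]; split.
  apply: (@smaller_copies _ _ S _ beta 1 0 (fun psi _ => tau psi) (no_ord _)) =>
    //.
  by move=> _ [psi Spsi <-]; left; exists psi => //; exists ord0.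
apply: (smaller_copies (f := gamma) (g := p) alpha_inf Sa) => b.
case=> _ [psi Spsi <-] b_occ.
have [[a psia ab]|?] := translates_parameters (tauP _ Spsi) b_occ; last by right.
by left; exists a => //; exists psi.
Qed.

Lemma bounded_tr_ob alpha beta (O : PLS A) :
  infinite_bound alpha -> infinite_bound beta ->
  bounded_obj alpha beta O -> bounded_obj alpha beta (tr_functor O).
Proof.
move=> alpha_inf beta_inf; case: O => [//|m X] [S Sb XS].
pose S' := S `|` [set tautology A _].
have S'0 : S' !=set0 by exists (tautology A _); right.
have [T trS] := trans_set_exists S'.
exists T; last by rewrite (logset_trans_set S'0 trS) logset_setU1_true -XS.
exact: trans_set_bounded (system_bounded_setU1_true beta_inf Sb) trS.
Qed.

Lemma tr_functor_restricts alpha beta :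
  infinite_bound alpha -> infinite_bound beta ->
  restricts tr_functor alpha beta.
Proof.
move=> alpha_inf beta_inf.
pose ob (O : PLSb A alpha beta) : PLSb B alpha beta :=
  exist _ (tr_ob (sval O)) (bounded_tr_ob alpha_inf beta_inf (proj2_sig O)).
exists (@Functor (PLSb A alpha beta) (PLSb B alpha beta) ob
  (fun O O' => @tr_mor (sval O) (sval O'))
  (fun O => tr_mor_id (sval O)) (fun O1 O2 O3 => @tr_mor_cmp _ _ _)).
by rewrite /functor_cmp /=; congr Functor; exact: Prop_irrelevance.
Qed.

(** * Interpretations and functors *)

Lemma coordinates_functor :
  exists F : functor (PLS A) (PLS B),
    [/\ is_interpretation_functor p gamma F,
        embedding F
      & forall alpha beta : cardinal_bound,
          infinite_bound alpha -> infinite_bound beta ->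
          bound_le alpha beta ->
          functor_conditions p gamma alpha beta /\
          restricts F alpha beta].
Proof.
exists tr_functor; split.
- exact: tr_functor_interpretation.
- exact: tr_functor_embedding.
- move=> alpha beta alpha_inf beta_inf _.
  by split; [exact: coordinates_conditions|exact: tr_functor_restricts].
Qed.

End Functor.

Theorem theorem9 (LA LB : language) (A : structure LA) (B : structure LB) :
  (forall (G : code LA LB) (p : 'I_(cpar G) -> B) (mu : {b | dom p b} -> A),
     is_interpretation mu ->
     exists (gamma : A -> 'I_(cdim G) -> B)
            (gamma_dom : forall a, dom p (gamma a)),
       (forall a, mu (exist _ (gamma a) (gamma_dom a)) = a) /\
       exists F : functor (PLS A) (PLS B),
         [/\ is_interpretation_functor p gamma F,
             embedding F
           & forall alpha beta : cardinal_bound,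
               infinite_bound alpha -> infinite_bound beta ->
               bound_le alpha beta ->
               functor_conditions p gamma alpha beta /\
               restricts F alpha beta])
  /\
  (forall (G : code LA LB) (p : 'I_(cpar G) -> B)
          (gamma : A -> 'I_(cdim G) -> B),
     functor_conditions p gamma Infty Infty ->
     exists (mu : {b | dom p b} -> A)
            (gamma_dom : forall a, dom p (gamma a)),
       [/\ is_interpretation mu,
           forall a, mu (exist _ (gamma a) (gamma_dom a)) = a
         & exists F : functor (PLS A) (PLS B),
             [/\ is_interpretation_functor p gamma F,
                 embedding F
               & forall alpha beta : cardinal_bound,
                   infinite_bound alpha -> infinite_bound beta ->
                   bound_le alpha beta ->
                   functor_conditions p gamma alpha beta /\
                   restricts F alpha beta]]).
Proof.
split=> [G p mu /interpretation_coordinates[gamma [gamma_dom [h [sect hP]]]]|].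
  by exists gamma, gamma_dom; split=> //; exact: coordinates_functor hP.
move=> G p gamma conds.
have [h hP] := coordinates_of_emptiness (fc_empty conds).
exists (fun b => h (sval b)), (co_dom hP); split.
- exact: coordinates_interpretation hP.
- exact: co_section hP.
- exact: coordinates_functor hP.
Qed.
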